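(* Let $N=1$ and let $f\in\mathcal{C}^2([0,1])$ satisfy $f(0)=f(1)=0$ and the bistability hypothesis: there exists $\beta^*\in(0,1)$ such that $\int_0^{\beta^*}f=0$, $\int_0^{u}f<0$ for all $u\in(0,\beta^* )$, $f(u)>0$ for all $u\in(\beta^*,1)$, $f'(1)<0$ and $f'(0)<0$. Let $$\mathcal{B}:=\Big\{u_0\in L^1(\mathbb{R}),\ 0\le u_0\le1,\ \limsup_{t\to+\infty}\sup_{x\in\mathbb{R}}u(t,x)>0\Big\},$$ where $u$ denotes the solution of $u_t-u_{xx}=f(u)$ on $(0,\infty)\times\mathbb{R}$ with $u(0,\cdot)=u_0$. Let $W\in H^1(\mathbb{R})$ be a positive solution (with values in $[0,1]$) of $-W''=f(W)$ in $\mathbb{R}$. Then $W$ is not a minimizer of $u_0\mapsto\int_{\mathbb{R}}u_0$ over $\mathcal{B}$.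
   Context: Solutions of the Cauchy problem are the bounded solutions, which take values in $[0,1]$. *)

(* Defs.v *)
From HB Require Import structures.
From mathcomp Require Import all_boot all_order all_algebra.
From mathcomp Require Import all_classical all_reals all_analysis.

Set Implicit Arguments.
Unset Strict Implicit.
Unset Printing Implicit Defensive.

Import Order.TTheory GRing.Theory Num.Theory.
Import numFieldNormedType.Exports.

Local Open Scope classical_set_scope.
Local Open Scope ring_scope.

(* Only the values of f on A matter: at the endpoints of an interval A these
   are the one-sided difference quotients and derivatives. *)
Definition diffquo_on (R : realType) (A : set R) (f : R -> R) (x : R) :
    set_system R :=
  (fun y => (f y - f x) / (y - x)) @ within A x^'.

Definition derivable_on (R : realType) (A : set R) (f : R -> R) : Prop :=
  forall x, A x -> cvg (diffquo_on A f x).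

Definition derive_on (R : realType) (A : set R) (f : R -> R) (x : R) : R :=
  lim (diffquo_on A f x).

Definition C2_on (R : realType) (A : set R) (f : R -> R) : Prop :=
  [/\ derivable_on A f, derivable_on A (derive_on A f) &
      {within A, continuous (derive_on A (derive_on A f))}].

Definition bistable (R : realType) (f : R -> R) : Prop :=
  exists beta : R,
    [/\ 0 < beta < 1,
        \int[lebesgue_measure]_(s in `[0, beta]) f s = 0,
        (forall u, 0 < u < beta ->
          \int[lebesgue_measure]_(s in `[0, u]) f s < 0),
        (forall u, beta < u < 1 -> 0 < f u) &
        derive_on `[0, 1] f 1 < 0 /\ derive_on `[0, 1] f 0 < 0].

(* u is C^1 in t and C^2 in x on (0, +oo) x R, solves the equation there
   pointwise, takes values in [0, 1], and attains the (a.e. defined) initial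
   datum u0 in L^1_loc as t -> 0+.  The values u t for t <= 0 are irrelevant. *)
Definition cauchy_solution (R : realType) (f u0 : R -> R) (u : R -> R -> R) :
    Prop :=
  (forall t x : R, 0 < t ->
    [/\ derivable (u ^~ x) t 1, derivable (u t) x 1,
        derivable (derive1 (u t)) x 1 & 0 <= u t x <= 1]) /\
  (forall t x : R, 0 < t ->
    [/\ {for (t, x), continuous (fun p : R * R => u p.1 p.2)},
        {for (t, x), continuous (fun p : R * R => derive1 (u ^~ p.2) p.1)},
        {for (t, x), continuous (fun p : R * R => derive1 (u p.1) p.2)} &
        {for (t, x), continuous (fun p : R * R => derive1n 2 (u p.1) p.2)}]) /\
  (forall t x : R, 0 < t ->
    derive1 (u ^~ x) t - derive1n 2 (u t) x = f (u t x)) /\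
  (forall a b : R,
    \int[lebesgue_measure]_(x in `[a, b]) `|u t x - u0 x| @[t --> 0^'+] --> 0).

(* Bounded solutions of the Cauchy problem exist and are unique for
   such data, so "the solution" is rendered by the existential. *)
Definition persistent_data (R : realType) (f : R -> R) : set (R -> R) :=
  [set u0 | [/\ u0 \in Lfun lebesgue_measure 1%E,
                {ae lebesgue_measure, forall x, 0 <= u0 x <= 1} &
                exists2 u, cauchy_solution f u0 u &
                  (0 < limf_esup
                    (fun t => ereal_sup (range (fun x => (u t x)%:E)))
                    +oo%R)%E]].

Definition test_function (R : realType) (phi : R -> R) : Prop :=
  (forall (n : nat) (x : R), derivable (derive1n n phi) x 1) /\
  (exists M : R, forall x, M < `|x| -> phi x = 0).

Definition weak_derivative (R : realType) (w g : R -> R) : Prop :=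
  forall phi, test_function phi ->
    \int[lebesgue_measure]_x (w x * derive1 phi x) =
    - \int[lebesgue_measure]_x (g x * phi x).

Definition H1 (R : realType) (w : R -> R) : Prop :=
  w \in Lfun lebesgue_measure 2%:E /\
  exists2 g, g \in Lfun lebesgue_measure 2%:E & weak_derivative w g.

Definition stationary_solution (R : realType) (f w : R -> R) : Prop :=
  forall x : R, [/\ derivable w x 1, derivable (derive1 w) x 1 &
                - derive1n 2 w x = f (w x)].

Definition is_minimizer (T : Type) (R : realType) (J : T -> R) (B : set T)
    (w : T) : Prop :=
  B w /\ forall v, B v -> J w <= J v.

(* Main.v *)
(* Let L = d^2/dx^2 + f'(W) be the linearization at W, and x0 a maximum point
   of W.  On the half-line s (x - x0) >= 0 (s = 1 or -1) the function
     h = - s W' + eta exp(- 2 K s (x - x0)) - gam,   |f'| <= K,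
   satisfies L h > 0: the first term is in the kernel of L, the second one is a
   strict subsolution, and - gam f'(W) > 0 in the tails, where f'(W) < 0, while
   in the core it is absorbed by the exponential.  Since W'' (x0) < 0, the two
   branches form a convex kink at x0, so w = max(0, W + eps h) is a stationary
   subsolution for small eps, with w(x0) >= W(x0).  As |W'| <= K W, w is below
   the positive part of (1 + eps C) W - eps gam, hence below the smooth function
     v = a W^2 / (W + b),   a = 1 + eps C,   a b = eps gam.
   Here v <= a W, with a gain of at least eps gam / 2 wherever W >= b.  This set
   grows to the whole line as eps -> 0, so the gain beats the excess
   eps C \int W and \int v < \int W.

   It remains to solve the Cauchy problem with datum v by some u >= w.  The
   monotone scheme
     u_{n+1}(x) = (u_n(x+h) + u_n(x-h) + 2 u_n(x)) / 4 + (h^2/4) f(u_n(x))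
   preserves [0, 1] and the discrete subsolution w.  Differentiating it gives
   bounds on u_n', u_n'' and a modulus of continuity in x of u_n'', all uniform
   in h; a quadratic barrier turns moduli in x into moduli in time.  All these
   estimates pass to the pointwise limit along an ultrafilter as h -> 0, which
   is therefore a classical solution. *)
Require Import Defs.
From mathcomp Require Import all_boot all_order all_algebra.
From mathcomp Require Import all_classical all_reals all_analysis.
From mathcomp Require Import measurable_realfun ring lra.
Import Order.TTheory GRing.Theory Num.Theory.
Import numFieldNormedType.Exports.
Local Open Scope classical_set_scope.
Local Open Scope ring_scope.

(** * Derivatives on the real line *)

Section calculus.
Context {R : realType}.
Implicit Types (F D : R -> R) (A : set R) (x y z h : R).

(** The derivative relative to [A], one-sided at an endpoint of an interval, in a quotient-free
    form: pieces on adjacent intervals glue by taking the smaller [d]. *)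
Definition deriv_within A F D := forall x, A x -> forall e, 0 < e ->
  exists2 d, 0 < d & forall y, A y -> `|y - x| <= d ->
    `|F y - F x - D x * (y - x)| <= e * `|y - x|.

Lemma deriv_within_glue A F D a : deriv_within (A `&` [set x | x <= a]) F D ->
  deriv_within (A `&` [set x | a <= x]) F D -> deriv_within A F D.
Proof.
move=> L U x Ax e e0; have [xa|ax|xa] := ltgtP x a.
- have [d d0 H] := L x (conj Ax (ltW xa)) e e0.
  exists (Num.min d (a - x)); first by rewrite lt_min d0 subr_gt0.
  move=> y Ay; rewrite le_min => /andP[yd ya]; apply: H => //=; split=> //=.
  by have := ler_norm (y - x); lra.
- have [d d0 H] := U x (conj Ax (ltW ax)) e e0.
  exists (Num.min d (x - a)); first by rewrite lt_min d0 subr_gt0.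
  move=> y Ay; rewrite le_min => /andP[yd ya]; apply: H => //=; split=> //=.
  by have := ler_norm (x - y); rewrite distrC; lra.
- have xa1 : x <= a by rewrite xa.
  have xa2 : a <= x by rewrite xa.
  have [d1 d10 H1] := L x (conj Ax xa1) e e0.
  have [d2 d20 H2] := U x (conj Ax xa2) e e0.
  exists (Num.min d1 d2); first by rewrite lt_min d10.
  move=> y Ay; rewrite le_min => /andP[yd1 yd2].
  by have [ya|/ltW ay] := leP y a; [exact: H1|exact: H2].
Qed.

Lemma is_derive_epsP F x d : is_derive x 1 F d <-> forall e, 0 < e ->
  exists2 r : R, 0 < r &
    forall y, `|y - x| <= r -> `|F y - F x - d * (y - x)| <= e * `|y - x|.
Proof.
split=> [/is_derive1_caratheodory[k [kE kc kx]] e e0|H].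
- have /cvgrPdist_le/(_ e e0) := kc.
  rewrite /prop_near1/= => /nbhs_ballP[r /= r0 Hr].
  exists (r / 2) => [|y yr]; first by rewrite divr_gt0.
  rewrite kE -mulrBl normrM ler_wpM2r// -kx distrC; apply: Hr.
  by rewrite /ball/= distrC (le_lt_trans yr)// ltr_pdivrMr// ltr_pMr// ltr1n.
- apply/is_derive1_caratheodory.
  exists (fun y => if y == x then d else (F y - F x) / (y - x)); split.
  + move=> y; case: eqP => [->|/eqP yx]; first by rewrite !subrr mulr0.
    by rewrite divfK// subr_eq0.
  + apply/cvgrPdist_le => e e0; have [r r0 Hr] := H e e0.
    apply/nbhs_ballP; exists r => //= y xy; rewrite eqxx.
    case: eqP => [_|/eqP yx]; first by rewrite subrr normr0 ltW.
    have yx0 : 0 < `|y - x| by rewrite normr_gt0 subr_eq0.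
    rewrite -(ler_pM2r yx0) -normrM mulrBl divfK ?subr_eq0// distrC.
    by apply: Hr; rewrite distrC ltW.
  + by rewrite eqxx.
Qed.

Lemma is_deriveP F D : (forall x, is_derive x 1 F (D x)) <-> deriv_within setT F D.
Proof.
split=> [H x _ e e0|H x].
- have /is_derive_epsP/(_ e e0)[r r0 Hr] := H x.
  by exists r => // y _; exact: Hr.
- by apply/is_derive_epsP => e /(H x I)[r r0 Hr]; exists r => // y; exact: Hr.
Qed.

Lemma is_derive_continuous F x d : is_derive x 1 F d -> {for x, continuous F}.
Proof. by move=> [? _]; exact/differentiable_continuous/derivable1_diffP. Qed.

#[global] Instance is_derive_expR_comp F x d : is_derive x 1 F d ->
  is_derive x 1 (fun y => expR (F y)) (expR (F x) * d).
Proof. by move=> dF; apply: (is_derive1_comp (is_derive_expR _)). Qed.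

Lemma mean_value F D x y : x <= y ->
  (forall z, x <= z <= y -> is_derive z 1 F (D z)) ->
  exists2 z, x <= z <= y & F y - F x = D z * (y - x).
Proof.
move=> xy H; have [||z] := @MVT_segment R F D x y xy.
- by move=> z; rewrite in_itv/= => /andP[/ltW a /ltW b]; apply: H; rewrite a b.
- apply: continuous_in_subspaceT => z; rewrite inE/= in_itv/= => /H.
  exact: is_derive_continuous.
- by rewrite in_itv/= => zxy E; exists z.
Qed.

Lemma mean_value_abs F D x y : (forall z : R, is_derive z 1 F (D z)) ->
  exists2 z, `|z - x| <= `|y - x| & F y - F x = D z * (y - x).
Proof.
move=> H; have [xy|/ltW yx] := leP x y.
- have [z /andP[xz zy] E] := @mean_value F D x y xy (fun z _ => H z).
  by exists z => //; rewrite !ger0_norm; lra.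
- have [z /andP[xz zy] E] := @mean_value F D y x yx (fun z _ => H z).
  by exists z; [rewrite !ler0_norm|]; lra.
Qed.

Lemma lipschitz_derive F D B x y : (forall z : R, is_derive z 1 F (D z)) ->
  (forall z, `|D z| <= B) -> `|F y - F x| <= B * `|y - x|.
Proof.
move=> H HB; have [z _ ->] := @mean_value_abs F D x y H.
by rewrite normrM ler_wpM2r.
Qed.

Lemma taylor1 F D e x y : (forall z : R, is_derive z 1 F (D z)) ->
  (forall z, `|z - x| <= `|y - x| -> `|D z - D x| <= e) ->
  `|F y - F x - D x * (y - x)| <= e * `|y - x|.
Proof.
move=> H HB; have [z zy ->] := @mean_value_abs F D x y H.
by rewrite -mulrBl normrM ler_wpM2r// HB.
Qed.

Lemma nondecreasing_derive F D x y : x <= y ->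
  (forall z, x <= z <= y -> is_derive z 1 F (D z)) ->
  (forall z, x <= z <= y -> 0 <= D z) -> F x <= F y.
Proof.
move=> xy H H0; have [z zxy E] := @mean_value F D x y xy H.
by rewrite -subr_ge0 E mulr_ge0 ?H0// subr_ge0.
Qed.

(** Subtracting the parabola of second derivative [q] leaves a function [G] with nondecreasing
    derivative, so its mean-value slopes on the two sides of [x] are ordered. The hypotheses are
    local because the lower bound for the subsolution is available only near [x]. *)
Lemma second_difference_ge F F1 F2 q x h : 0 <= h ->
  (forall z, x - h <= z <= x + h -> is_derive z 1 F (F1 z)) ->
  (forall z, x - h <= z <= x + h -> is_derive z 1 F1 (F2 z)) ->
  (forall z, x - h <= z <= x + h -> q <= F2 z) ->
  q * h ^+ 2 <= F (x + h) + F (x - h) - 2 * F x.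
Proof.
move=> h0 dF dF1 qF.
pose G y := F y - q / 2 * (y - x) ^+ 2.
pose G1 y := F1 y - q * (y - x).
have dG z : x - h <= z <= x + h -> is_derive z 1 G (G1 z).
  move=> /dF dFz; apply: is_derive_eq.
  rewrite /G1 /GRing.scale/=. lra.
have dG1 z : x - h <= z <= x + h -> is_derive z 1 G1 (F2 z - q).
  by move=> /dF1 dFz; apply: is_derive_eq; rewrite /GRing.scale/=; ring.
have [||z1 z1h E1] := @mean_value G G1 x (x + h).
- by lra.
- by move=> z zh; apply: dG; lra.
have [||z2 z2h E2] := @mean_value G G1 (x - h) x.
- by lra.
- by move=> z zh; apply: dG; lra.
have : G1 z2 <= G1 z1.
  apply: (@nondecreasing_derive _ (fun z => F2 z - q)) => [|z zz|z zz].
  - by lra.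
  - by apply: dG1; lra.
  - by rewrite subr_ge0; apply: qF; lra.
move=> G10; have : 0 <= (G1 z1 - G1 z2) * h by rewrite mulr_ge0// subr_ge0.
have -> : (G1 z1 - G1 z2) * h = (G (x + h) - G x) - (G x - G (x - h)).
  by rewrite E1 E2; ring.
by rewrite /G; lra.
Qed.

Lemma second_difference F F1 F2 e x h : 0 <= h ->
  (forall z : R, is_derive z 1 F (F1 z)) -> (forall z : R, is_derive z 1 F1 (F2 z)) ->
  (forall z, `|z - x| <= h -> `|F2 z - F2 x| <= e) ->
  `|F (x + h) + F (x - h) - 2 * F x - F2 x * h ^+ 2| <= e * h ^+ 2.
Proof.
move=> h0 dF dF1 F2e.
have F2e' z : x - h <= z <= x + h -> `|F2 z - F2 x| <= e.
  by move=> zh; apply: F2e; rewrite ler_norml; lra.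
have L := @second_difference_ge F F1 F2 (F2 x - e) x h h0
  (fun z _ => dF z) (fun z _ => dF1 z).
have U := @second_difference_ge (\- F) (\- F1) (\- F2) (- (F2 x + e)) x h h0
  (fun z _ => is_deriveN (dF z)) (fun z _ => is_deriveN (dF1 z)).
have {}L : (F2 x - e) * h ^+ 2 <= F (x + h) + F (x - h) - 2 * F x.
  by apply: L => z /F2e'; rewrite ler_norml; lra.
have {}U : - (F2 x + e) * h ^+ 2 <= - F (x + h) + - F (x - h) - 2 * - F x.
  by apply: U => z /F2e'; rewrite ler_norml/=; lra.
by rewrite ler_norml; lra.
Qed.

End calculus.

(** * Extension of the nonlinearity *)

(** Compactness in covering form: a property that holds near each point for all small [i] holds on
    the whole segment for one common [i]. *)
Lemma heine_itv {R : realType} (F : R -> R) (a b : R) :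
  {within `[a, b], continuous F} -> forall e, 0 < e -> exists2 d, 0 < d &
  forall x y, a <= x <= b -> a <= y <= b -> `|x - y| <= d -> `|F x - F y| <= e.
Proof.
move=> /subspace_continuousP cF e e0.
have /compact_near_coveringP cK := @segment_compact R a b.
pose P (i x : R) := a <= x <= b -> forall y, a <= y <= b -> `|x - y| <= i ->
  `|F x - F y| <= e.
have [x abx|] := cK R (nbhs 0^'+) P _.
  have /cvgrPdist_le/(_ (e / 2)) := cF x abx.
  rewrite divr_gt0// near_withinE => /(_ isT)/nbhs_ballP[d /= d0 Hd].
  have {}Hd y : a <= y <= b -> `|x - y| < d -> `|F x - F y| <= e / 2.
    by move=> aby xy; apply: Hd; rewrite //= in_itv.
  exists (ball x (d / 2), [set i | i < d / 2]) => /=.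
    have d20 : 0 < d / 2 by rewrite divr_gt0.
    by split; [exact: nbhsx_ballx|exact: nbhs_right_lt].
  move=> [x' i]/= [xx' id] abx' y aby x'y.
  have {}xx' : `|x - x'| < d / 2 := xx'.
  have Fx' : `|F x - F x'| <= e / 2 by apply: Hd => //; lra.
  have Fy : `|F x - F y| <= e / 2.
    by apply: Hd => //; have := ler_distD x' x y; lra.
  by have := ler_distD (F x) (F x') (F y); rewrite (distrC (F x') (F x)); lra.
move=> d /= d0 Hd; exists (d / 2); first by rewrite divr_gt0.
move=> x y abx aby xy; apply: (Hd (d / 2)) => //=.
- by rewrite /ball/= sub0r normrN ger0_norm ?divr_ge0 ?ltW// gtr_pMr// invf_lt1 ?ltr1n.
- by rewrite divr_gt0.
Qed.

Section extension.
Context {R : realType}.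
Implicit Types (f l r F D : R -> R) (A : set R) (x y z h : R).

Lemma deriv_within_eq A F D F' D' : {in A, F =1 F'} -> {in A, D =1 D'} ->
  deriv_within A F D -> deriv_within A F' D'.
Proof.
move=> FF DD H x Ax e e0; have [d d0 Hd] := H x Ax e e0.
exists d => // y Ay; rewrite -!FF ?inE// -DD ?inE//; exact: Hd.
Qed.

Lemma deriv_within_sub A B F D : A `<=` B -> deriv_within B F D -> deriv_within A F D.
Proof.
move=> AB H x Ax e e0; have [d d0 Hd] := H x (AB _ Ax) e e0.
by exists d => // y /AB; exact: Hd.
Qed.

Lemma deriv_within_derive_on A f : derivable_on A f ->
  deriv_within A f (derive_on A f).
Proof.
move=> H x Ax e e0.
have /cvgrPdist_le/(_ e e0) : diffquo_on A f x --> derive_on A f x := H x Ax.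
rewrite near_withinE near_withinE => /nbhs_ballP[d /= d0 Hd].
exists (d / 2) => [|y Ay yd]; first by rewrite divr_gt0.
have [->|yx] := eqVneq y x; first by rewrite !subrr mulr0 subrr normr0 mulr0.
have yx0 : 0 < `|y - x| by rewrite normr_gt0 subr_eq0.
rewrite -[f y - f x](@divfK _ (y - x)) ?subr_eq0// -mulrBl normrM ler_wpM2r//.
rewrite distrC; apply: Hd => //=.
by rewrite /ball/= distrC (le_lt_trans yd)// ltr_pdivrMr// ltr_pMr// ltr1n.
Qed.

Definition unit_glue l f r x := if x < 0 then l x else if x <= 1 then f x else r x.

Lemma is_derive_unit_glue l f r l' f' r' :
  (forall x, is_derive x 1 l (l' x)) -> (forall x, is_derive x 1 r (r' x)) ->
  deriv_within `[0, 1] f f' ->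
  l 0 = f 0 -> l' 0 = f' 0 -> r 1 = f 1 -> r' 1 = f' 1 ->
  forall x, is_derive x 1 (unit_glue l f r) (unit_glue l' f' r' x).
Proof.
move=> /is_deriveP dl /is_deriveP dr df l0 l0' r1 r1'; apply/is_deriveP.
have le1 x : x <= 0 -> x <= 1 by move/le_trans; apply.
apply: (@deriv_within_glue _ _ _ _ 0); last apply: (@deriv_within_glue _ _ _ _ 1).
- apply: deriv_within_eq (deriv_within_sub _ _ _ _ (@subsetT _ _) dl) => x;
    rewrite inE /unit_glue => -[_ /= x0]; case: ltgtP x0 => // -> _;
    by rewrite ler01.
- apply: deriv_within_eq (deriv_within_sub _ `[0, 1] _ _ _ df) => [x|x|x].
  + by rewrite inE /unit_glue => -[[_ /= x0] /= x1]; rewrite ltNge x0 x1.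
  + by rewrite inE /unit_glue => -[[_ /= x0] /= x1]; rewrite ltNge x0 x1.
  + by rewrite /= in_itv/= => -[[_ ->] ->].
- apply: deriv_within_eq (deriv_within_sub _ _ _ _ (@subsetT _ _) dr) => x;
    rewrite inE /unit_glue => -[[_ /= x0] /= x1]; rewrite ltNge x0/=;
    by case: ltgtP x1 => // <- _.
Qed.

(** The perturbations of [W] may leave [0, 1], and the estimates use global bounds on the
    derivatives of the nonlinearity; hence an extension to the whole line. Taking [1 <= K] gives
    [K <= K ^+ 2] later. *)
Lemma C2_extension f : C2_on `[0, 1] f ->
  exists g g1 g2 : R -> R, exists K : R,
  [/\ (forall x, is_derive x 1 g (g1 x)) /\ (forall x, is_derive x 1 g1 (g2 x)),
      1 <= K, (forall x, `|g1 x| <= K) /\ (forall x, `|g2 x| <= K),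
      {within `[0, 1], continuous g2} &
      (forall x, 0 <= x <= 1 -> g x = f x) /\ g1 0 = derive_on `[0, 1] f 0].
Proof.
move=> [/deriv_within_derive_on + /deriv_within_derive_on].
set f1 := derive_on _ f; set f2 := derive_on _ f1 => df df1 cf2.
have bounded_itv F : {within `[0, 1], continuous F} ->
    exists2 B : R, 0 <= B & forall x, 0 <= x <= 1 -> `|F x| <= B.
  move=> cF; have [|c _ Hc] := @EVT_max R (fun x => `|F x|) 0 1 ler01.
    by move=> x; apply: cvg_norm; exact: cF.
  by exists `|F c| => // x x01; exact: Hc.
have [B2 B20 f2B] := bounded_itv f2 cf2.
have cf1 : {within `[0, 1], continuous f1}.
  apply/subspace_continuousP => x Ax; apply/cvgrPdist_le => e e0.
  have [d d0 Hd] := df1 x Ax 1 ltr01.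
  pose C := 1 + `|f2 x|; have C0 : 0 < C by rewrite ltr_pwDl.
  rewrite near_withinE; apply/nbhs_ballP; exists (Num.min d (e / C)).
    by rewrite /= lt_min d0 divr_gt0.
  move=> y; rewrite /ball/= lt_min distrC => /andP[/ltW yd /ltW ye] Ay.
  have := Hd y Ay yd; rewrite ler_pdivlMr// in ye.
  move: ye; rewrite /C (distrC (f1 x)) => ye H.
  have -> : f1 y - f1 x = (f1 y - f1 x - f2 x * (y - x)) + f2 x * (y - x) by ring.
  by rewrite (le_trans (ler_normD _ _))// normrM; lra.
have [B1 B10 f1B] := bounded_itv f1 cf1.
(* Tails with exponentially decaying second derivative keep [g1] bounded. *)
exists (unit_glue (fun x => f 0 + f1 0 * x + f2 0 * (expR x - 1 - x)) f
  (fun x => f 1 + f1 1 * (x - 1) + f2 1 * (expR (1 - x) - 1 - (1 - x)))).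
exists (unit_glue (fun x => f1 0 + f2 0 * (expR x - 1)) f1
  (fun x => f1 1 + f2 1 * (1 - expR (1 - x)))).
exists (unit_glue (fun x => f2 0 * expR x) f2 (fun x => f2 1 * expR (1 - x))).
exists (1 + B1 + B2); split.
- split; apply: is_derive_unit_glue => //; rewrite ?subrr ?expR0; try lra.
  + by move=> x; apply: is_derive_eq; rewrite /GRing.scale/=; ring.
  + by move=> x; apply: is_derive_eq; rewrite /GRing.scale/=; ring.
  + by move=> x; apply: is_derive_eq; rewrite /GRing.scale/=; ring.
  + by move=> x; apply: is_derive_eq; rewrite /GRing.scale/=; ring.
- lra.
- have expB a x : x <= 0 -> `|a| <= B2 -> `|a * expR x| <= B2.
    move=> x0 aB; rewrite normrM (ger0_norm (expR_ge0 _)).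
    by rewrite (le_trans _ aB)// ler_piMr// -expR0 ler_expR.
  have f20 : `|f2 0| <= B2 by apply: f2B; rewrite lexx ler01.
  have f21 : `|f2 1| <= B2 by apply: f2B; rewrite lexx ler01.
  have f10 : `|f1 0| <= B1 by apply: f1B; rewrite lexx ler01.
  have f11 : `|f1 1| <= B1 by apply: f1B; rewrite lexx ler01.
  have tailB a b x : x <= 0 -> `|a| <= B1 -> `|b| <= B2 ->
      `|a + b * (expR x - 1)| <= 1 + B1 + B2.
    move=> x0 aB bB; rewrite (le_trans (ler_normD _ _))// normrM.
    have : `|expR x - 1| <= 1.
      have := expR_ge0 x; have : expR x <= 1 by rewrite -expR0 ler_expR.
      by rewrite ler_norml; lra.
    by move=> /(ler_wpM2l (normr_ge0 b)); lra.
  split => x; rewrite /unit_glue.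
  + case: (ltP x 0) => [x0|x0]; first by apply: tailB => //; exact: ltW.
    case: (leP x 1) => [x1|x1]; first by have := f1B x; rewrite x0 x1 => /(_ isT); lra.
    rewrite (_ : _ + _ = f1 1 + - f2 1 * (expR (1 - x) - 1)); last by ring.
    by apply: tailB; rewrite ?normrN//; lra.
  + case: (ltP x 0) => [x0|x0]; first by have := expB (f2 0) x (ltW x0) f20; lra.
    case: (leP x 1) => [x1|x1]; first by have := f2B x; rewrite x0 x1 => /(_ isT); lra.
    by have := expB (f2 1) (1 - x) _ f21; lra.
- apply: (@subspace_eq_continuous _ _ _ f2) => // x.
  rewrite inE/= in_itv/= => /andP[x0 x1].
  by rewrite /unit_glue /from_subspace/= ltNge x0 x1.
- split=> [x /andP[x0 x1]|]; first by rewrite /unit_glue ltNge x0 x1.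
  by rewrite /unit_glue ltxx ler01.
Qed.
End extension.

(** * The averaging operator *)

Section scheme.
Context {R : realType}.
Implicit Types (u w : R -> R) (x y z h a b c m e t d B K Q T : R) (n k : nat).

(** The weights 1/4, 1/2, 1/4 leave half of the mass at the centre; that half pays for the reaction
    term when the scheme is applied to two ordered functions. *)
Definition avg h u x := (u (x + h) + u (x - h) + 2 * u x) / 4.

(* The time step for which [avg h u - u] is close to [tstep h * u'']. *)
Definition tstep h : R := h ^+ 2 / 4.

Lemma tstep_ge0 h : 0 <= tstep h.
Proof. by rewrite divr_ge0// sqr_ge0. Qed.

Definition scheme (g : R -> R) h u x := avg h u x + tstep h * g (u x).

Lemma avg_dist h u m x y : (forall z, `|u (x + z) - u (y + z)| <= m) ->
  `|avg h u x - avg h u y| <= m.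
Proof.
move=> um; move: (um h) (um (- h)) (um 0); rewrite !addr0 /avg !ler_norml; lra.
Qed.

Lemma avg_norm h u m x : (forall y, `|u y| <= m) -> `|avg h u x| <= m.
Proof.
move=> um; move: (um (x + h)) (um (x - h)) (um x).
by rewrite /avg !ler_norml; lra.
Qed.

Lemma expR_ge1 x : 0 <= x -> 1 <= expR x.
Proof. by move=> x0; have := expR_ge1Dx x; lra. Qed.

(** A closed-form majorant of [n] Euler steps of length [t] for y' = K y + c with y(0) = a. *)
Definition gronwall K a c t n : R :=
  (a + n%:R * t * c) * expR (K * (n%:R * t)).

Lemma gronwallS K a c t n : 0 <= K -> 0 <= a -> 0 <= c -> 0 <= t ->
  (1 + t * K) * gronwall K a c t n + t * c <= gronwall K a c t n.+1.
Proof.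
move=> K0 a0 c0 t0; rewrite /gronwall -natr1.
have -> : K * ((n%:R + 1) * t) = t * K + K * (n%:R * t) by ring.
rewrite expRD.
have n0 : 0 <= n%:R :> R by exact: ler0n.
have nt0 : 0 <= n%:R * t by rewrite mulr_ge0.
have A0 : 0 <= a + n%:R * t * c by rewrite addr_ge0// mulr_ge0.
have E1 : 1 + t * K <= expR (t * K) by exact: expR_ge1Dx.
have E2 : 1 <= expR (K * (n%:R * t)).
  by rewrite expR_ge1// mulr_ge0.
have E3 : 1 <= expR (t * K) by rewrite expR_ge1// mulr_ge0.
set E := expR (t * K) in E1 E3 *; set G := expR _ in E2 *.
have -> : (a + (n%:R + 1) * t * c) * (E * G) =
  (a + n%:R * t * c) * G * E + t * c * (E * G) by ring.
apply: lerD; first by rewrite mulrC ler_wpM2l// mulr_ge0//; lra.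
rewrite -[leLHS]mulr1 ler_wpM2l ?mulr_ge0//.
by rewrite -[leLHS]mulr1 ler_pM.
Qed.

Lemma gronwall0 K a c t : gronwall K a c t 0 = a.
Proof. by rewrite /gronwall !mul0r mulr0 expR0 addr0 mulr1. Qed.

Lemma gronwall_le K a c t n T : 0 <= K -> 0 <= a -> 0 <= c -> 0 <= t ->
  n%:R * t <= T -> gronwall K a c t n <= (a + T * c) * expR (K * T).
Proof.
move=> K0 a0 c0 t0 nT; have nt0 : 0 <= n%:R * t by rewrite mulr_ge0.
rewrite /gronwall ler_pM ?expR_ge0// ?addr_ge0 ?mulr_ge0//.
  by rewrite lerD2l ler_wpM2r.
by rewrite ler_expR ler_wpM2l.
Qed.

(* The quadratic [c0 + Q (y - x) ^+ 2] gains exactly [2 Q t] per averaging step. *)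
Lemma avg_barrier h (w : nat -> R -> R) c c0 Q x k :
  (forall n y, (n < k)%N -> w n.+1 y <= avg h (w n) y + tstep h * c) ->
  (forall y, w 0%N y <= c0 + Q * (y - x) ^+ 2) ->
  w k x <= c0 + k%:R * tstep h * (2 * Q + c).
Proof.
move=> wS w0.
suff H n y : (n <= k)%N ->
    w n y <= c0 + Q * (y - x) ^+ 2 + n%:R * tstep h * (2 * Q + c).
  by have := H k x (leqnn k); rewrite subrr expr0n/= mulr0 addr0.
elim: n y => [|n IH] y nk; first by rewrite !mul0r addr0.
have {}IH z := IH z (ltnW nk).
rewrite (le_trans (wS n y nk))// -natr1.
have := IH (y + h); have := IH (y - h); have := IH y.
rewrite /avg /tstep; lra.
Qed.

(** The datum differs from its value at [x] by at most [e] within distance [d] and by at most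
    [2 * B] elsewhere, hence everywhere by at most [e + Q * (y - x) ^+ 2] with [Q = 2 * B / d ^+ 2].
    The quadratic barrier then applies to [w] and to [- w]. *)
Lemma avg_time_modulus h (w : nat -> R -> R) B c e d x k :
  0 <= B -> 0 < d ->
  (forall n y, (n < k)%N -> `|w n.+1 y - avg h (w n) y| <= tstep h * c) ->
  (forall y, `|w 0%N y| <= B) ->
  (forall y, `|y - x| <= d -> `|w 0%N y - w 0%N x| <= e) ->
  `|w k x - w 0%N x| <= e + k%:R * tstep h * (4 * B / d ^+ 2 + c).
Proof.
move=> B0 d0 wS wB we.
pose Q := 2 * B / d ^+ 2; have Q0 : 0 <= Q by rewrite divr_ge0 ?sqr_ge0 ?mulr_ge0.
have e0 : 0 <= e by have := we x; rewrite !subrr normr0 => /(_ (ltW d0)).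
have Qd y : d <= `|y - x| -> 2 * B <= Q * (y - x) ^+ 2.
  move=> dy; rewrite /Q -mulrA ler_peMr ?mulr_ge0//.
  rewrite mulrC ler_pdivlMr ?exprn_gt0// mul1r -(real_normK (num_real (y - x))).
  by rewrite lerXn2r// nnegrE ltW.
have Qge0 y : 0 <= Q * (y - x) ^+ 2 by rewrite mulr_ge0// sqr_ge0.
have Q4 : 4 * B / d ^+ 2 = 2 * Q by rewrite /Q; ring.
have main y : `|w 0%N y - w 0%N x| <= e + Q * (y - x) ^+ 2.
  have [yd|/ltW yd] := leP `|y - x| d; first by have := we y yd; have := Qge0 y; lra.
  have := Qd y yd; have := wB x; have := wB y.
  have := ler_normB (w 0%N y) (w 0%N x); lra.
have U : w k x <= w 0%N x + e + k%:R * tstep h * (2 * Q + c).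
  apply: avg_barrier => [n y nk|y].
    by have := wS n y nk; rewrite ler_norml; lra.
  by have := main y; rewrite ler_norml; lra.
have L : - w k x <= - w 0%N x + e + k%:R * tstep h * (2 * Q + c).
  apply: (@avg_barrier h (fun n y => - w n y)) => [n y nk|y].
    by have := wS n y nk; rewrite /avg ler_norml; lra.
  by have := main y; rewrite ler_norml; lra.
by rewrite Q4 ler_norml; lra.
Qed.

End scheme.

(** * Limits of the scheme *)

Section bounded_limits.
Context {R : realType}.

Lemma fmap_ultra_filter (S T : Type) (f : S -> T) (F : set_system S) :
  UltraFilter F -> UltraFilter (f @ F).
Proof.
move=> FU; split; first exact: fmap_proper_filter.
move=> G GP FG; rewrite eqEsubset; split=> // A GA.
have [//|FA] := in_ultra_setVsetC (f @^-1` A) FU.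
by have [x [Ax nAx]] := @filter_ex _ _ GP _ (filterI GA (FG (~` A) FA)).
Qed.

(** The image of [F] is an ultrafilter on a compact interval, so it converges. *)
Lemma ultra_bounded_cvg (F : set_system nat) (FU : UltraFilter F) (a : nat -> R) C :
  (forall m, `|a m| <= C) -> a m @[m --> F] --> lim (a m @[m --> F]).
Proof.
move=> aC; have aFU : UltraFilter (a m @[m --> F]) by exact: fmap_ultra_filter.
have := @segment_compact R (- C) C; rewrite compact_ultra => /(_ _ aFU)[|l [_ al]].
  by apply: (@filterE _ F) => m; rewrite /= in_itv/= -ler_norml.
by apply/cvg_ex; exists l.
Qed.

Lemma cvg_norm_le (F : set_system nat) (FF : ProperFilter F) (a : nat -> R) l e :
  a m @[m --> F] --> l -> (\forall m \near F, `|a m| <= e) -> `|l| <= e.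
Proof.
move=> al ae; rewrite leNgt; apply/negP => el.
have el0 : 0 < `|l| - e by rewrite subr_gt0.
have /cvgrPdist_lt/(_ _ el0) Hl := al.
have [m [m1 m2]] := @filter_ex _ _ _ _ (filterI Hl ae).
have := ler_normD (l - a m) (a m); rewrite subrK; lra.
Qed.

End bounded_limits.

(** * Joint continuity and integrals over short ranges of values *)

Section joint_continuity.
Context {R : realType}.
Implicit Types (W : R -> R -> R) (s t x y : R).

Lemma joint_continuous W :
  (forall T, 0 <= T -> forall e, 0 < e -> exists2 d : R, 0 < d &
    forall s t x y, 0 <= s <= T -> 0 <= t <= T -> `|t - s| <= d ->
    `|x - y| <= d -> `|W t x - W s y| <= e) ->
  forall t x, 0 < t -> {for (t, x), continuous (fun p : R * R => W p.1 p.2)}.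
Proof.
move=> HW t x t0; apply/cvgrPdist_le => e e0.
have T0 : 0 <= t + 1 by rewrite addr_ge0// ltW.
have [d d0 Hd] := HW _ T0 e e0.
have r0 : 0 < Num.min (Num.min 1 t) d by rewrite !lt_min ltr01 t0.
exists (ball t (Num.min (Num.min 1 t) d), ball x d).
  by split; exact: nbhsx_ballx.
move=> [s y] [/= ts xy].
have {}xy : `|x - y| < d := xy.
have : `|t - s| < Num.min (Num.min 1 t) d := ts.
rewrite !lt_min => /andP[/andP[s1 st] sd].
apply: Hd; [|lra|exact: ltW|exact: ltW].
by move: s1 st; rewrite !ltr_norml; lra.
Qed.

Lemma Rintegral_itv_le (F : R -> R) a b e : continuous F -> 0 <= e ->
  (forall x, 0 <= F x <= e) ->
  `|\int[lebesgue_measure]_(x in `[a, b]) F x| <= e * `|b - a|.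
Proof.
move=> cF e0 Fe; have mab : measurable (`[a, b]%classic : set (measurableTypeR R)).
  exact: measurable_itv.
rewrite ger0_norm; last by apply: Rintegral_ge0 => x _; have /andP[] := Fe x.
have icF (G : R -> R) : continuous G ->
    lebesgue_measure.-integrable `[a, b] (EFin \o G).
  move=> cG; apply: continuous_compact_integrable; first exact: segment_compact.
  exact: continuous_subspaceT.
apply: (@le_trans _ _ (\int[lebesgue_measure]_(x in `[a, b]) (cst e) x)).
  apply: le_Rintegral => //.
  - exact: icF.
  - by apply: icF => x; exact: cvg_cst.
  - by move=> x _; have /andP[] := Fe x.
rewrite Rintegral_cst// ler_wpM2l//.
suff : fine (lebesgue_measure ([set` `[a, b]%R] : set R)) <= `|b - a| by [].
rewrite lebesgue_measure_itv/= lte_fin.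
by case: ltP => /= [ab|_]; [exact: ler_norm|exact: normr_ge0].
Qed.

End joint_continuity.

(** * Passage to the limit along an ultrafilter *)

Section limit.
Context {R : realType}.
Implicit Types (x y z s t e d T : R) (m n k : nat).

(** [Z m n] stands for the iterate number [n] with time step [tau m], and [Z1], [Z2] for its first
    two space derivatives. The hypotheses collect bounds and joint moduli of continuity uniform in
    [m], and, for large [m], consistency with the equation over [k] steps. *)
Variables (g : R -> R) (K : R) (tau : nat -> R) (Z Z1 Z2 : nat -> nat -> R -> R).
Hypothesis K0 : 0 <= K.
Hypothesis gL : forall x y, `|g x - g y| <= K * `|x - y|.
Hypothesis tau0 : forall m, 0 < tau m.
Hypothesis tau_cvg : forall e, 0 < e -> \forall m \near \oo, tau m <= e.
Hypothesis Z01 : forall m n x, 0 <= Z m n x <= 1.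
Hypothesis ZC : forall T, 0 <= T -> exists C : R, forall m n x,
  n%:R * tau m <= T -> `|Z1 m n x| <= C /\ `|Z2 m n x| <= C.
Hypothesis dZ : forall m n x, is_derive x 1 (Z m n) (Z1 m n x).
Hypothesis dZ1 : forall m n x, is_derive x 1 (Z1 m n) (Z2 m n x).
Hypothesis Zmod : forall T, 0 <= T -> forall e, 0 < e -> exists2 d : R, 0 < d &
  forall m n k x y, (n + k)%:R * tau m <= T -> k%:R * tau m <= d ->
  `|x - y| <= d ->
  [/\ `|Z m (n + k) x - Z m n y| <= e, `|Z1 m (n + k) x - Z1 m n y| <= e &
      `|Z2 m (n + k) x - Z2 m n y| <= e].
Hypothesis Zt : forall T, 0 <= T -> forall e, 0 < e -> exists2 d : R, 0 < d &
  \forall m \near \oo, forall n k x, (n + k)%:R * tau m <= T ->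
  k%:R * tau m <= d ->
  `|Z m (n + k) x - Z m n x - k%:R * tau m * (Z2 m n x + g (Z m n x))|
    <= k%:R * tau m * e.

Variable F : set_system nat.
Hypothesis FU : UltraFilter F.
Hypothesis Foo : \oo `<=` F.

Let FP : ProperFilter F. Proof. exact: ultra_proper. Qed.

(** The number of whole steps completed by time [t]. It is 0 for negative [t], so that [|t|] serves
    as a time horizon for every [t]. *)
Definition idx m t := Num.truncn (t / tau m).

Lemma idx_le m t : 0 <= t -> (idx m t)%:R * tau m <= t.
Proof.
by move=> t0; rewrite -ler_pdivlMr// /idx truncn_le divr_ge0// ltW.
Qed.

Lemma idx_gt m t : t < (idx m t)%:R * tau m + tau m.
Proof.
rewrite -[X in _ + X]mul1r -mulrDl natr1 -ltr_pdivrMr//; exact: truncnS_gt.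
Qed.

Lemma idx_le_norm m t : (idx m t)%:R * tau m <= `|t|.
Proof.
have [t0|t0] := leP 0 t; first by rewrite ger0_norm// idx_le.
rewrite /idx (_ : Num.truncn _ = 0%N) ?mul0r//.
by apply/truncn0Pn; rewrite -ltNge ltr_pdivrMr// mul1r (lt_trans t0).
Qed.

(* Along an ultrafilter every bounded sequence converges, so that no Cauchy
   estimate between different mesh sizes is needed. *)
Definition ulim (W : nat -> nat -> R -> R) t x : R :=
  lim (W m (idx m t) x @[m --> F]).

Lemma Z_cvg t x : Z m (idx m t) x @[m --> F] --> ulim Z t x.
Proof.
apply: (@ultra_bounded_cvg _ _ _ _ 1) => m.
by have /andP[? ?] := Z01 m (idx m t) x; rewrite ger0_norm.
Qed.

Lemma Z1_cvg t x : Z1 m (idx m t) x @[m --> F] --> ulim Z1 t x.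
Proof.
have [C HC] := ZC _ (normr_ge0 t); apply: (@ultra_bounded_cvg _ _ _ _ C) => m.
exact: (HC m _ x (idx_le_norm m t)).1.
Qed.

Lemma Z2_cvg t x : Z2 m (idx m t) x @[m --> F] --> ulim Z2 t x.
Proof.
have [C HC] := ZC _ (normr_ge0 t); apply: (@ultra_bounded_cvg _ _ _ _ C) => m.
exact: (HC m _ x (idx_le_norm m t)).2.
Qed.

(** Both times are rounded down to the grid, so the discrete elapsed time is off by at most one
    step; this is also why it may reach [2 * d]. *)
Lemma idx_split T m s t d : 0 <= s -> s <= t -> t <= T -> t - s <= d ->
  tau m <= d -> exists k, [/\ idx m t = (idx m s + k)%N,
    (idx m s + k)%:R * tau m <= T, k%:R * tau m <= 2 * d &
    `|k%:R * tau m - (t - s)| <= tau m].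
Proof.
move=> s0 st tT tsd td; exists (idx m t - idx m s)%N.
have kE : (idx m s + (idx m t - idx m s))%N = idx m t.
  by rewrite subnKC// le_truncn// ler_pM2r ?invr_gt0.
have := idx_le m s s0; have := idx_le m t (le_trans s0 st).
have := idx_gt m s; have := idx_gt m t.
have : (idx m t)%:R = (idx m s)%:R + (idx m t - idx m s)%:R :> R.
  by rewrite -natrD kE.
move=> E; rewrite kE E mulrDl.
set a := (idx m s)%:R * tau m; set b := (_ - _)%:R * tau m => h1 h2 h3 h4.
by split=> //; rewrite ?ler_norml; lra.
Qed.

Lemma ulim_modulus T : 0 <= T -> forall e, 0 < e -> exists2 d : R, 0 < d &
  forall s t x y, 0 <= s <= T -> 0 <= t <= T -> `|t - s| <= d -> `|x - y| <= d ->
  [/\ `|ulim Z t x - ulim Z s y| <= e, `|ulim Z1 t x - ulim Z1 s y| <= e &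
      `|ulim Z2 t x - ulim Z2 s y| <= e].
Proof.
move=> T0 e e0; have [d d0 Hd] := Zmod T T0 e e0.
have d20 : 0 < d / 2 by rewrite divr_gt0.
exists (d / 2) => // s t x y.
wlog st : s t x y / s <= t.
  move=> wl sT tT ts xy; have [st|/ltW ts'] := leP s t; first exact: wl.
  rewrite (distrC (ulim Z t x)) (distrC (ulim Z1 t x)) (distrC (ulim Z2 t x)).
  by apply: wl => //; rewrite distrC.
move=> /andP[s0 _] /andP[_ tT]; rewrite ger0_norm ?subr_ge0// => ts xy.
have key : \forall m \near F,
  [/\ `|Z m (idx m t) x - Z m (idx m s) y| <= e,
      `|Z1 m (idx m t) x - Z1 m (idx m s) y| <= e &
      `|Z2 m (idx m t) x - Z2 m (idx m s) y| <= e].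
  apply: filterS (Foo _ (tau_cvg _ d20)) => m md.
  have [k [-> kT kd _]] := idx_split T m s t (d / 2) s0 st tT ts md.
  by apply: Hd => //; [move: kd|move: xy]; lra.
split.
- apply: cvg_norm_le (cvgB (Z_cvg t x) (Z_cvg s y)) _.
  by apply: filterS key => m [].
- apply: cvg_norm_le (cvgB (Z1_cvg t x) (Z1_cvg s y)) _.
  by apply: filterS key => m [].
- apply: cvg_norm_le (cvgB (Z2_cvg t x) (Z2_cvg s y)) _.
  by apply: filterS key => m [].
Qed.

Lemma g_cts : continuous g.
Proof.
move=> x; apply/cvgrPdist_le => e e0.
have K10 : 0 < K + 1 by rewrite ltr_wpDl.
apply/nbhs_ballP; exists (e / (K + 1)); first by rewrite /= divr_gt0.
move=> y xy; have {}xy : `|x - y| < e / (K + 1) := xy.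
by rewrite ltr_pdivlMr// in xy; have := gL x y; have := normr_ge0 (x - y); lra.
Qed.

(** The consistency of the scheme over [k] steps passes to the limit, with [k%:R * tau m] tending to
    [t - s]. *)
Lemma ulim_consistency T : 0 <= T -> forall e, 0 < e -> exists2 d : R, 0 < d &
  forall s t x, 0 <= s -> s <= t -> t <= T -> t - s <= d ->
  `|ulim Z t x - ulim Z s x - (t - s) * (ulim Z2 s x + g (ulim Z s x))|
    <= (t - s) * e.
Proof.
move=> T0 e e0; have [d d0 Hd] := Zt T T0 e e0.
have d20 : 0 < d / 2 by rewrite divr_gt0.
exists (d / 2) => // s t x s0 st tT ts.
pose Q m := Z2 m (idx m s) x + g (Z m (idx m s) x).
pose q := ulim Z2 s x + g (ulim Z s x).
have Qq : Q m @[m --> F] --> q.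
  apply: cvgD; first exact: Z2_cvg.
  by apply: continuous_cvg; [exact: g_cts|exact: Z_cvg].
(* The slack [r] absorbs the rounding of the elapsed time: an error of at most [tau m], multiplied
   by [e] plus the bound [|q| + 1] of [Q m]. *)
apply/ler_addgt0Pr => r r0; have q10 : 0 < `|q| + 1 + e by rewrite addr_gt0// ltr_wpDl.
apply: (@cvg_norm_le R F FP (fun m => Z m (idx m t) x - Z m (idx m s) x - (t - s) * Q m)).
  by apply: cvgB; [apply: cvgB; exact: Z_cvg|apply: cvgMr].
have /cvgrPdist_lt/(_ 1 ltr01) Qq1 := Qq.
have r10 : 0 < r / (`|q| + 1 + e) by rewrite divr_gt0.
near=> m.
have Qm : `|q - Q m| < 1 by near: m.
have md : tau m <= d / 2 by near: m; exact: Foo _ (tau_cvg _ d20).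
have mr : tau m <= r / (`|q| + 1 + e) by near: m; exact: Foo _ (tau_cvg _ r10).
rewrite ler_pdivlMr// in mr.
have [k [-> kT kd kts]] := idx_split T m s t (d / 2) s0 st tT ts md.
have kd' : k%:R * tau m <= d by lra.
have Hm : forall n k x, (n + k)%:R * tau m <= T -> k%:R * tau m <= d ->
  `|Z m (n + k) x - Z m n x - k%:R * tau m * (Z2 m n x + g (Z m n x))|
    <= k%:R * tau m * e by near: m; exact: Foo _ Hd.
have {Hm} := Hm _ _ x kT kd'; rewrite -/(Q m).
set A := Z m _ x; set A0 := Z m _ x; set kt := k%:R * tau m in kts *.
move=> H; rewrite (_ : A - A0 - (t - s) * Q m =
  (A - A0 - kt * Q m) + (kt - (t - s)) * Q m); last by ring.
rewrite (le_trans (ler_normD _ _))// normrM.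
have QC : `|Q m| <= `|q| + 1.
  by have := ler_normB q (q - Q m); rewrite subKr; lra.
have := ler_pM (normr_ge0 _) (normr_ge0 _) kts QC.
have kte : (kt - (t - s)) * e <= tau m * e.
  by rewrite ler_wpM2r ?(ltW e0)// (le_trans (ler_norm _)).
lra.
Unshelve. all: by end_near. Qed.

(** The first-order Taylor remainder is small uniformly in [m], because the derivatives share a
    modulus of continuity; such a bound survives the limit. *)
Lemma ulim_is_derive t x : is_derive x 1 (ulim Z t) (ulim Z1 t x) /\
  is_derive x 1 (ulim Z1 t) (ulim Z2 t x).
Proof.
have lem (W D : nat -> nat -> R -> R) :
    (forall m n x, is_derive x 1 (W m n) (D m n x)) ->
    (forall t x, W m (idx m t) x @[m --> F] --> ulim W t x) ->
    (forall t x, D m (idx m t) x @[m --> F] --> ulim D t x) ->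
    (forall T, 0 <= T -> forall e, 0 < e -> exists2 d : R, 0 < d &
      forall m n x y, n%:R * tau m <= T -> `|x - y| <= d ->
      `|D m n x - D m n y| <= e) ->
    is_derive x 1 (ulim W t) (ulim D t x).
  move=> dW cW cD mD; apply/is_derive_epsP => e e0.
  have [d d0 Hd] := mD _ (normr_ge0 t) e e0.
  exists d => // y yx.
  apply: (@cvg_norm_le R F FP (fun m =>
    W m (idx m t) y - W m (idx m t) x - D m (idx m t) x * (y - x))).
    by apply: cvgB; [apply: cvgB; exact: cW|apply: cvgMl; exact: cD].
  apply: (@filterE _ F) => m; apply: taylor1 => // z zx.
  by apply: Hd; [exact: idx_le_norm|exact: le_trans yx].
have Zmod0 T (T0 : 0 <= T) e (e0 : 0 < e) : exists2 d : R, 0 < d &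
    forall m n x y, n%:R * tau m <= T -> `|x - y| <= d ->
    `|Z1 m n x - Z1 m n y| <= e /\ `|Z2 m n x - Z2 m n y| <= e.
  have [d d0 Hd] := Zmod T T0 e e0; exists d => // m n z y nT zy.
  have := Hd m n 0%N z y; rewrite addn0 mul0r => /(_ nT (ltW d0) zy).
  by case.
split.
- apply: lem => //; [exact: Z_cvg|exact: Z1_cvg|].
  move=> T T0 e e0; have [d d0 Hd] := Zmod0 T T0 e e0.
  by exists d => // m n z y nT zy; have [] := Hd m n z y nT zy.
- apply: lem => //; [exact: Z1_cvg|exact: Z2_cvg|].
  move=> T T0 e e0; have [d d0 Hd] := Zmod0 T T0 e e0.
  by exists d => // m n z y nT zy; have [] := Hd m n z y nT zy.
Qed.

(** To the right of [t] this is [ulim_consistency] based at [t]. To the left the estimate is based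
    at [s < t], and moving the slope from [s] to [t] costs another [e / 2] by the moduli of [ulim Z]
    and [ulim Z2]. *)
Lemma ulim_time_derive t x : 0 < t ->
  is_derive t 1 (ulim Z ^~ x) (ulim Z2 t x + g (ulim Z t x)).
Proof.
move=> t0; apply/is_derive_epsP => e e0.
have T0 : 0 <= t + 1 by rewrite addr_ge0// ltW.
have K10 : 0 < 1 + K by rewrite ltr_pwDl.
have e20 : 0 < e / 2 by rewrite divr_gt0.
have e40 : 0 < e / 2 / (1 + K) by rewrite divr_gt0.
have [d1 d10 H1] := ulim_consistency (t + 1) T0 _ e20.
have [d2 d20 H2] := ulim_modulus (t + 1) T0 _ e40.
exists (Num.min (Num.min 1 t) (Num.min d1 d2)).
  by rewrite !lt_min ltr01 t0 d10.
move=> s; rewrite !le_min => /andP[/andP[s1 st]] /andP[sd1 sd2].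
have [ts|ts] := leP t s.
  rewrite ger0_norm ?subr_ge0// in s1 st sd1 sd2 *.
  rewrite -(mulrC (s - t)) (le_trans (H1 t s x _ ts _ sd1))//.
  - exact: ltW.
  - lra.
  - by rewrite mulrC ler_wpM2r ?subr_ge0//; lra.
have [] := H2 s t x x; rewrite ?subrr ?normr0 ?(ltW d20) 1?distrC//.
- by move: st; rewrite ler0_norm; lra.
- lra.
move=> M0 _ M2.
rewrite distrC in s1 st sd1 sd2 *.
rewrite [`|t - s|]ger0_norm ?subr_ge0 ?(ltW ts)// in s1 st sd1 sd2 *.
have := H1 s t x _ (ltW ts) _ sd1.
have s0 : 0 <= s by lra.
have t1 : t <= t + 1 by lra.
move=> /(_ s0 t1).
have := gL (ulim Z t x) (ulim Z s x).
rewrite distrC in M0; move: M0 M2; set U := ulim Z t x; set V := ulim Z s x.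
set P := ulim Z2 t x; set P' := ulim Z2 s x => M0 M2 gUV C.
have aE : (1 + K) * (e / 2 / (1 + K)) = e / 2 by rewrite mulrC divfK// gt_eqF.
have := ler_wpM2l K0 M0; move: aE M0 M2; set a := e / 2 / (1 + K) => aE M0 M2 KM.
have PQ : `|(t - s) * (P + g U - (P' + g V))| <= (t - s) * (e / 2).
  rewrite normrM ger0_norm ?subr_ge0 ?(ltW ts)// ler_wpM2l ?subr_ge0 ?(ltW ts)//.
  rewrite opprD addrACA (le_trans (ler_normD _ _))//; lra.
move: C PQ; rewrite !ler_norml; lra.
Qed.

Lemma ulim_cauchy_solution f v : (forall m x, Z m 0 x = v x) ->
  (forall x, 0 <= x <= 1 -> f x = g x) -> cauchy_solution f v (ulim Z).
Proof.
move=> Zv fg.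
have u01 t x : 0 <= ulim Z t x <= 1.
  (* The interval [0, 1] is written as a closed ball so that [cvg_norm_le] applies. *)
  have H : `|ulim Z t x - 1 / 2| <= 1 / 2.
    apply: (@cvg_norm_le R F FP (fun m => Z m (idx m t) x - 1 / 2)).
      by apply: cvgB; [exact: Z_cvg|exact: cvg_cst].
    by apply: (@filterE _ F) => m; have := Z01 m (idx m t) x; rewrite ler_norml; lra.
  by move: H; rewrite ler_norml; lra.
have p1E t : derive1 (ulim Z t) = ulim Z1 t.
  apply/funext => x; rewrite derive1E.
  by have [d1 _] := ulim_is_derive t x; rewrite derive_val.
have p2E t : derive1n 2 (ulim Z t) = ulim Z2 t.
  apply/funext => x; rewrite /derive1n /= p1E derive1E.
  by have [_ d2] := ulim_is_derive t x; rewrite derive_val.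
have ptE t x : 0 < t -> derive1 (ulim Z ^~ x) t = ulim Z2 t x + g (ulim Z t x).
  by move=> t0; rewrite derive1E; have dt := ulim_time_derive t x t0; rewrite derive_val.
have u0E x : ulim Z 0 x = v x.
  rewrite /ulim (_ : (fun m => _) = cst (v x)) ?lim_cst//.
  by apply/funext => m; rewrite /idx mul0r truncn0 Zv.
have [c0 c1 c2] : [/\ forall t x, 0 < t ->
    {for (t, x), continuous (fun p : R * R => ulim Z p.1 p.2)},
    forall t x, 0 < t -> {for (t, x), continuous (fun p : R * R => ulim Z1 p.1 p.2)} &
    forall t x, 0 < t -> {for (t, x), continuous (fun p : R * R => ulim Z2 p.1 p.2)}].
  split; apply: joint_continuous => T T0 e e0;
    have [d d0 Hd] := ulim_modulus T T0 e e0; exists d => // s t x y sT tT ts xy;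
    by have [] := Hd s t x y sT tT ts xy.
split; [|split; [|split]].
- move=> t x t0; have [d1 d2] := ulim_is_derive t x; have dt := ulim_time_derive t x t0.
  by split=> //; rewrite p1E.
- move=> t x t0; split; first exact: c0.
  + rewrite /prop_for /continuous_at /= ptE//.
    have H : (ulim Z2 p.1 p.2 + g (ulim Z p.1 p.2)) @[p --> (t, x)] -->
        ulim Z2 t x + g (ulim Z t x).
      apply: cvgD; first exact: c2.
      exact: (cvg_comp _ g (c0 t x t0) (g_cts _)).
    apply: cvg_trans H; apply: near_eq_cvg.
    exists ([set s | 0 < s], setT) => /=.
      by split; [exact: lt_nbhsr|exact: filterT].
    by move=> [s y] [/= s0 _]; rewrite ptE.
  + have -> : (fun p : R * R => derive1 (ulim Z p.1) p.2) =
        (fun p => ulim Z1 p.1 p.2) by apply/funext => p; rewrite p1E.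
    exact: c1.
  + have -> : (fun p : R * R => derive1n 2 (ulim Z p.1) p.2) =
        (fun p => ulim Z2 p.1 p.2) by apply/funext => p; rewrite p2E.
    exact: c2.
- by move=> t x t0; rewrite ptE// p2E fg// addrAC subrr add0r.
- move=> a b; apply/cvgrPdist_le => e e0.
  (* The datum is attained uniformly, by the modulus at time 0; integrating over [[a, b]] multiplies
     the error by at most [|b - a|]. *)
  have r0 : 0 < e / (1 + `|b - a|) by rewrite divr_gt0// ltr_pwDl.
  have [d d0 Hd] := ulim_modulus 1 ler01 _ r0.
  have d10 : 0 < Num.min 1 d by rewrite lt_min ltr01.
  near=> t.
  have t0 : 0 < t by near: t; exact: nbhs_right_gt.
  have : t <= Num.min 1 d by near: t; exact: nbhs_right_le.
  rewrite le_min => /andP[t1 td]; rewrite sub0r normrN.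
  apply: le_trans (Rintegral_itv_le _ _ _ _ _ (ltW r0) _) _.
  + move=> x; apply: cvg_norm; apply: cvgB.
      by have [d1 _] := ulim_is_derive t x; exact: is_derive_continuous d1.
    rewrite -u0E (_ : v = ulim Z 0); last by apply/funext => y; rewrite u0E.
    by have [d1 _] := ulim_is_derive 0 x; exact: is_derive_continuous d1.
  + move=> x; rewrite normr_ge0 -u0E.
    have [] := Hd 0 t x x; rewrite ?subr0 ?subrr ?normr0 ?lexx ?ler01 ?(ltW d0)//.
    * by rewrite t1 ltW.
    * by rewrite ger0_norm// ltW.
  + rewrite -[leRHS](@divfK _ (1 + `|b - a|)) ?gt_eqF ?ltr_pwDl//.
    by rewrite ler_wpM2l ?ltW// ltrDr.
Unshelve. all: by end_near. Qed.

Lemma ulim_ge w t x : (\forall m \near \oo, forall n y, w y <= Z m n y) ->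
  w x <= ulim Z t x.
Proof.
move=> /Foo wZ; apply/ler_addgt0Pr => e e0.
have /cvgrPdist_lt/(_ e e0) H := Z_cvg t x.
have [m [m1 m2]] := @filter_ex _ _ FP _ (filterI wZ H).
by have := m1 (idx m t) x; move: m2; rewrite ltr_norml; lra.
Qed.

End limit.

(** * Uniform estimates for the scheme *)

Section iterates.
Context {R : realType}.
Implicit Types (u w : R -> R) (x y z h a b c m e t d B Q T : R) (n k : nat).

Variables (g g1 g2 : R -> R) (K : R).
Hypothesis dg : forall x, is_derive x 1 g (g1 x).
Hypothesis dg1 : forall x, is_derive x 1 g1 (g2 x).
Hypothesis K1 : 1 <= K.
Hypothesis g1K : forall x, `|g1 x| <= K.
Hypothesis g2K : forall x, `|g2 x| <= K.
Hypothesis g2c : forall e, 0 < e -> exists2 d : R, 0 < d & forall x y,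
  0 <= x <= 1 -> 0 <= y <= 1 -> `|x - y| <= d -> `|g2 x - g2 y| <= e.
Hypothesis g_0 : g 0 = 0.
Hypothesis g_1 : g 1 = 0.

Variables (v v1 v2 : R -> R) (B : R).
Hypothesis dv : forall x, is_derive x 1 v (v1 x).
Hypothesis dv1 : forall x, is_derive x 1 v1 (v2 x).
Hypothesis v01 : forall x, 0 <= v x <= 1.
Hypothesis v1B : forall x, `|v1 x| <= B.
Hypothesis v2B : forall x, `|v2 x| <= B.
Hypothesis v2L : forall x y, `|v2 x - v2 y| <= B * `|x - y|.

Let K0 : 0 <= K. Proof. exact: le_trans K1. Qed.
Let B0 : 0 <= B. Proof. exact: le_trans (v1B 0). Qed.

Lemma g_lip x y : `|g x - g y| <= K * `|x - y|.
Proof. exact: lipschitz_derive. Qed.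

Lemma g1_lip x y : `|g1 x - g1 y| <= K * `|x - y|.
Proof. exact: lipschitz_derive. Qed.

Lemma g_le x : 0 <= x <= 1 -> `|g x| <= K.
Proof.
move=> x01; have := g_lip x 0; rewrite g_0 !subr0 => /le_trans; apply.
by rewrite ger0_norm ?(andP x01).1// ler_piMr// (andP x01).2.
Qed.

(** Monotonicity: the weight 1/2 of the centre value dominates the reaction term, whose Lipschitz
    constant is [tstep h * K]. *)
Lemma scheme_le h u w x : tstep h * K <= 1 / 2 -> u x <= w x ->
  u (x + h) <= w (x + h) -> u (x - h) <= w (x - h) ->
  scheme g h u x <= scheme g h w x.
Proof.
move=> hK; rewrite /scheme /avg; set a := u x; set b := w x => ab pab mab.
suff : tstep h * (g a - g b) <= (b - a) / 2 by lra.
have gab : g a - g b <= K * (b - a).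
  rewrite (le_trans (ler_norm _))// (le_trans (g_lip a b))//.
  by rewrite distrC ger0_norm// subr_ge0.
rewrite (le_trans (ler_wpM2l (tstep_ge0 h) gab))//.
by rewrite mulrA mulrC ler_wpM2l ?subr_ge0//; lra.
Qed.

(* One step of the scheme, carrying along the first two space derivatives. *)
Definition step h (s : (R -> R) * (R -> R) * (R -> R)) :=
  (scheme g h s.1.1,
   fun x => avg h s.1.2 x + tstep h * (g1 (s.1.1 x) * s.1.2 x),
   fun x => avg h s.2 x +
     tstep h * (g1 (s.1.1 x) * s.2 x + g2 (s.1.1 x) * s.1.2 x ^+ 2)).

Definition iterate h n := iter n (step h) (v, v1, v2).
Definition approx h n := (iterate h n).1.1.
Definition approx1 h n := (iterate h n).1.2.
Definition approx2 h n := (iterate h n).2.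

Lemma is_derive_shift_comp u d x a : is_derive (x + a) 1 u d ->
  is_derive x 1 (fun y => u (y + a)) d.
Proof.
move=> du; have -> : (fun y => u (y + a)) = u \o (fun y => y + a) by [].
rewrite -[d]mulr1; apply: is_derive1_comp => //.
by apply: is_derive_eq; rewrite addr0.
Qed.

Lemma is_derive_avg h u u' : (forall x, is_derive x 1 u (u' x)) ->
  forall x, is_derive x 1 (avg h u) (avg h u' x).
Proof.
move=> du x; have dp := is_derive_shift_comp u _ x h (du (x + h)).
have dm := is_derive_shift_comp u _ x (- h) (du (x - h)).
rewrite /avg; apply: is_derive_eq; rewrite /GRing.scale/=; lra.
Qed.

Lemma is_derive_approx h n x : is_derive x 1 (approx h n) (approx1 h n x) /\
  is_derive x 1 (approx1 h n) (approx2 h n x).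
Proof.
elim: n x => [|n IH] x; first by split; [exact: dv|exact: dv1].
rewrite /approx /approx1 /approx2 /iterate !iterS -/(iterate h n) /step /=.
rewrite -/(approx h n) -/(approx1 h n) -/(approx2 h n).
have d0 y := (IH y).1; have d1 y := (IH y).2.
have a0 := is_derive_avg h _ _ d0 x; have a1 := is_derive_avg h _ _ d1 x.
have dgu : is_derive x 1 (fun y => g (approx h n y)) (g1 (approx h n x) * approx1 h n x).
  exact: is_derive1_comp.
have dg1u : is_derive x 1 (fun y => g1 (approx h n y)) (g2 (approx h n x) * approx1 h n x).
  exact: is_derive1_comp.
split; rewrite /scheme; apply: is_derive_eq; rewrite /GRing.scale/=; ring.
Qed.

Section step_size.
Variable h : R.
Hypothesis hK : tstep h * K <= 1 / 2.
Let th0 := @tstep_ge0 R h.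

Lemma approx_ge w : (forall x, w x <= scheme g h w x) -> (forall x, w x <= v x) ->
  forall n x, w x <= approx h n x.
Proof.
move=> ww wv; elim=> [//|n IH] x.
rewrite (le_trans (ww x))// /approx /iterate iterS -/(iterate h n) /step /=.
exact: scheme_le.
Qed.

Lemma approx_01 n x : 0 <= approx h n x <= 1.
Proof.
elim: n x => [//|n IH] x.
rewrite /approx /iterate iterS -/(iterate h n) /step /= -/(approx h n).
have IH0 y := (andP (IH y)).1; have IH1 y := (andP (IH y)).2.
(* The constants 0 and 1 are fixed by the scheme, since [g] vanishes at both. *)
have := @scheme_le h (cst 0) (approx h n) x hK (IH0 _) (IH0 _) (IH0 _).
have := @scheme_le h (approx h n) (cst 1) x hK (IH1 _) (IH1 _) (IH1 _).
by rewrite /scheme/= g_0 g_1 /avg/=; lra.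
Qed.

Lemma approx1_le n x : `|approx1 h n x| <= gronwall K B 0 (tstep h) n.
Proof.
elim: n x => [|n IH] x; first by rewrite gronwall0.
apply: le_trans (gronwallS _ _ _ _ _ K0 B0 (lexx _) th0).
rewrite /approx1 /iterate iterS -/(iterate h n) /step /= -/(approx h n) -/(approx1 h n).
rewrite (le_trans (ler_normD _ _))// mulr0 addr0 mulrDl mul1r.
rewrite lerD ?avg_norm// -mulrA normrM ger0_norm// ler_wpM2l// normrM.
by rewrite ler_pM.
Qed.

(** The recursion for [approx2] is linear with the source [g2 * approx1 ^+ 2], bounded by
    [K * C ^+ 2]. *)
Lemma approx2_le T C n x : n%:R * tstep h <= T ->
  (forall k y, k%:R * tstep h <= T -> `|approx1 h k y| <= C) ->
  `|approx2 h n x| <= gronwall K B (K * C ^+ 2) (tstep h) n.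
Proof.
move=> nT HC; have c0 : 0 <= K * C ^+ 2 by rewrite mulr_ge0// sqr_ge0.
elim: n nT x => [|n IH] nT x; first by rewrite gronwall0.
have nT' : n%:R * tstep h <= T by move: nT; have := th0; rewrite -natr1; lra.
apply: le_trans (gronwallS _ _ _ _ _ K0 B0 c0 th0).
rewrite /approx2 /iterate iterS -/(iterate h n) /step /=.
rewrite -/(approx h n) -/(approx1 h n) -/(approx2 h n).
rewrite (le_trans (ler_normD _ _))// mulrDl mul1r -addrA.
rewrite lerD ?avg_norm// => [y|]; first exact: IH.
rewrite -mulrA -mulrDr normrM ger0_norm// ler_wpM2l//.
rewrite (le_trans (ler_normD _ _))// lerD//.
  by rewrite normrM ler_pM// IH.
rewrite normrM ler_pM//.
by rewrite normrM expr2 ler_pM// HC.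
Qed.

End step_size.

(** A restriction of CFL type, under which the scheme is monotone. *)
Definition admissible h := tstep h * K <= 1 / 2.

Lemma approx_bounds T : 0 <= T -> exists2 C, K <= C /\ B <= C & forall h n x, admissible h ->
  n%:R * tstep h <= T -> `|approx1 h n x| <= C /\ `|approx2 h n x| <= C.
Proof.
move=> T0; pose E := expR (K * T); have E0 : 0 <= E := expR_ge0 _.
pose C1 := B * E; have C10 : 0 <= C1 by rewrite mulr_ge0.
pose C2 := (B + T * (K * C1 ^+ 2)) * E.
have KC0 : 0 <= K * C1 ^+ 2 by rewrite mulr_ge0// sqr_ge0.
have C20 : 0 <= C2 by rewrite mulr_ge0// addr_ge0// mulr_ge0.
exists (K + B + C1 + C2) => [|h n x hK nT].
  by have := K0; have := B0; split; lra.
have H1 k y : k%:R * tstep h <= T -> `|approx1 h k y| <= C1.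
  move=> kT; apply: le_trans (approx1_le h _ _) _.
  apply: le_trans (gronwall_le _ _ _ _ _ _ K0 B0 (lexx 0) (tstep_ge0 h) kT) _.
  by rewrite mulr0 addr0.
have H2 : `|approx2 h n x| <= C2.
  apply: le_trans (approx2_le h T C1 n x nT H1) _.
  exact: (gronwall_le _ _ _ _ _ _ K0 B0 KC0 (tstep_ge0 h) nT).
by have := H1 n x nT; have := K0; have := B0; split; lra.
Qed.

(** The difference of [approx2] at two points with fixed [x - y] obeys a linear recursion, whose
    source is small by the continuity of [g2] and the Lipschitz bounds on [approx] and [approx1]. As
    [g2] is merely continuous, a modulus takes the place of a bound on a third derivative. *)
Lemma approx2_modulus T : 0 <= T -> forall e, 0 < e -> exists2 d : R, 0 < d &
  forall h n x y, admissible h -> n%:R * tstep h <= T -> `|x - y| <= d ->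
  `|approx2 h n x - approx2 h n y| <= e.
Proof.
move=> T0 e e0; have [C [KC BC] HC] := approx_bounds T T0.
have C1 : 1 <= C by exact: le_trans KC.
have C0 : 0 < C by exact: lt_le_trans C1.
have E1 : 1 <= expR (K * T) by rewrite expR_ge1// mulr_ge0.
set E := expR (K * T) in E1.
have E0 : 0 < E by exact: lt_le_trans E1.
have T10 : 0 < 1 + T by rewrite ltr_pwDl.
(* Chosen so that the Gronwall bound with initial value [e'] and source [e'] is exactly [e] at time
   [T]. *)
pose e' := e / ((1 + T) * E).
have e'0 : 0 < e' by rewrite divr_gt0// mulr_gt0.
have e'E : e' * ((1 + T) * E) = e by rewrite divfK// gt_eqF// mulr_gt0.
clearbody e'.
have e2 : 0 < e' / 2 / C ^+ 2 by apply: divr_gt0; [rewrite divr_gt0|exact: exprn_gt0].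
have [d1 d10 Hd1] := g2c _ e2.
have C30 : 0 < C ^+ 3 by rewrite exprn_gt0.
(* In this order: values of [approx] become [d1]-close, so the [g2] increment costs [e' / 2]; the
   remaining source terms, at most [3 * C ^+ 3 * d] together, cost another [e' / 2]; the initial
   difference of [v2] is at most [e']. *)
pose d := Num.min (d1 / C) (Num.min (e' / 6 / C ^+ 3) (e' / C)).
have d0 : 0 < d by rewrite !lt_min !divr_gt0.
have [dd1 dd2 dd3] : [/\ C * d <= d1, C ^+ 3 * d <= e' / 6 & C * d <= e'].
  split; rewrite mulrC -ler_pdivlMr// /d !ge_min ?lexx ?orbT//.
exists d => // h n x y hK nT xy.
apply: (@le_trans _ _ (gronwall K e' e' (tstep h) n)); last first.
  apply: le_trans (gronwall_le _ _ _ _ _ _ K0 (ltW e'0) (ltW e'0) (tstep_ge0 h) nT) _.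
  by rewrite -/E -e'E; lra.
elim: n x y nT xy => [|n IH] x y nT xy.
  rewrite gronwall0 (le_trans (v2L x y))// (le_trans _ dd3)//.
  by rewrite ler_pM// BC.
have nT' : n%:R * tstep h <= T.
  by move: nT; have := tstep_ge0 h; rewrite -natr1; lra.
have {}IH z : `|approx2 h n (x + z) - approx2 h n (y + z)| <= gronwall K e' e' (tstep h) n.
  by apply: IH => //; rewrite (_ : _ - _ = x - y)//; ring.
apply: le_trans (gronwallS _ _ _ _ _ K0 (ltW e'0) (ltW e'0) (tstep_ge0 h)).
rewrite /approx2 /iterate iterS -/(iterate h n) /step /=.
rewrite -/(approx h n) -/(approx1 h n) -/(approx2 h n).
have := avg_dist h _ _ _ _ IH; move: (IH 0); rewrite !addr0.
set m := gronwall _ _ _ _ _.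
set p := approx2 h n x; set p' := approx2 h n y => pm.
set b := avg _ _ _; set b' := avg _ _ _ => bm.
have Cxy : C * `|x - y| <= C * d by rewrite ler_wpM2l// ltW.
have am : `|approx h n x - approx h n y| <= C * d.
  apply: le_trans Cxy.
  apply: (@lipschitz_derive _ _ (approx1 h n)) => z; first exact: (is_derive_approx h n z).1.
  exact: (HC h n z hK nT').1.
have qm : `|approx1 h n x - approx1 h n y| <= C * d.
  apply: le_trans Cxy.
  apply: (@lipschitz_derive _ _ (approx2 h n)) => z; first exact: (is_derive_approx h n z).2.
  exact: (HC h n z hK nT').2.
have p'C : `|p'| <= C := (HC h n y hK nT').2.
have qC : `|approx1 h n x| <= C := (HC h n x hK nT').1.
have q'C : `|approx1 h n y| <= C := (HC h n y hK nT').1.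
have g1m := g1_lip (approx h n x) (approx h n y).
have g2m : `|g2 (approx h n x) - g2 (approx h n y)| <= e' / 2 / C ^+ 2.
  by apply: Hd1; [exact: approx_01|exact: approx_01|exact: le_trans dd1].
move: am qm p'C qC q'C g1m g2m.
set a := approx h n x; set a' := approx h n y; set q := approx1 h n x; set q' := approx1 h n y.
move=> am qm p'C qC q'C g1m g2m.
have -> : b + tstep h * (g1 a * p + g2 a * q ^+ 2) -
    (b' + tstep h * (g1 a' * p' + g2 a' * q' ^+ 2)) = (b - b') + tstep h *
    (g1 a * (p - p') + (g1 a - g1 a') * p' + g2 a * ((q - q') * (q + q')) +
     (g2 a - g2 a') * q' ^+ 2) by ring.
rewrite [leRHS](_ : _ = m + tstep h * (K * m + e')); last by ring.
rewrite (le_trans (ler_normD _ _))// lerD//.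
rewrite normrM ger0_norm ?tstep_ge0// ler_wpM2l ?tstep_ge0//.
have t1 : `|g1 a * (p - p')| <= K * m by rewrite normrM ler_pM.
have t2 : `|(g1 a - g1 a') * p'| <= C ^+ 3 * d.
  rewrite normrM (_ : C ^+ 3 * d = C * (C * d) * C); last by ring.
  rewrite ler_pM// (le_trans g1m)// ler_pM//.
have t3 : `|g2 a * ((q - q') * (q + q'))| <= 2 * (C ^+ 3 * d).
  rewrite !normrM (_ : 2 * _ = C * ((C * d) * (2 * C))); last by ring.
  rewrite ler_pM//; first exact: le_trans (g2K _) KC.
  rewrite ler_pM// (le_trans (ler_normD _ _))//; lra.
have t4 : `|(g2 a - g2 a') * q' ^+ 2| <= e' / 2.
  rewrite normrM -[leRHS](@divfK _ (C ^+ 2)) ?gt_eqF ?exprn_gt0// ler_pM//.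
  by rewrite normrX lerXn2r// nnegrE ltW.
rewrite (le_trans (ler_normD _ _))// (le_trans (lerD (ler_normD _ _) (lexx _)))//.
rewrite (le_trans (lerD (lerD (ler_normD _ _) (lexx _)) (lexx _)))//.
lra.
Qed.

(** A modulus in space becomes one in time by restarting [avg_time_modulus] at step [n]. The summand
    1 in [q] only makes it positive. *)
Lemma evolution_modulus (W : R -> nat -> R -> R) T C c : 0 <= C -> 0 <= c ->
  (forall h n x, admissible h -> n%:R * tstep h <= T -> `|W h n x| <= C) ->
  (forall h n x, admissible h -> n%:R * tstep h <= T ->
    `|W h n.+1 x - avg h (W h n) x| <= tstep h * c) ->
  (forall e, 0 < e -> exists2 d : R, 0 < d & forall h n x y, admissible h ->
    n%:R * tstep h <= T -> `|x - y| <= d -> `|W h n x - W h n y| <= e) ->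
  forall e, 0 < e -> exists2 d : R, 0 < d & forall h n k x y, admissible h ->
    (n + k)%:R * tstep h <= T -> k%:R * tstep h <= d -> `|x - y| <= d ->
    `|W h (n + k)%N x - W h n y| <= e.
Proof.
move=> C0 c0 WC Wc Wmod e e0; have e40 : 0 < e / 4 by rewrite divr_gt0.
have [d d0 Hd] := Wmod _ e40.
pose q := 4 * C / d ^+ 2 + c + 1.
have q0 : 0 < q by rewrite ltr_wpDl// addr_ge0// divr_ge0 ?sqr_ge0 ?mulr_ge0.
exists (Num.min d (e / 4 / q)); first by rewrite lt_min d0 divr_gt0.
move=> h n k x y hK nkT; rewrite !le_min => /andP[_ kq] /andP[xyd _].
rewrite ler_pdivlMr// in kq.
have t0 := tstep_ge0 h.
have le_time j : (j <= n + k)%N -> j%:R * tstep h <= T.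
  by move=> jn; apply: le_trans nkT; rewrite ler_wpM2r// ler_nat.
have S1 : `|W h n x - W h n y| <= e / 4.
  by apply: Hd => //; apply: le_time; rewrite leq_addr.
have S2 : `|W h (n + k)%N x - W h n x| <= e / 4 + k%:R * tstep h * (4 * C / d ^+ 2 + c).
  have := @avg_time_modulus R h (fun j => W h (n + j)%N) C c (e / 4) d x k C0 d0.
  rewrite addn0; apply=> [j z jk|z|z zx].
  - by rewrite addnS; apply: Wc => //; apply: le_time; rewrite leq_add2l ltnW.
  - by apply: WC => //; apply: le_time; rewrite leq_addr.
  - by apply: Hd => //; apply: le_time; rewrite leq_addr.
have kt0 : 0 <= k%:R * tstep h by rewrite mulr_ge0.
have := ler_distD (W h n x) (W h (n + k)%N x) (W h n y).
rewrite /q in kq; lra.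
Qed.

(** In space, [approx] and [approx1] are Lipschitz through the bound on the next derivative, and
    [approx2] has its own modulus. In time, each one follows [avg] up to a source bounded by
    [K * C + K * C ^+ 2]. *)
Lemma approx_modulus T : 0 <= T -> forall e, 0 < e -> exists2 d : R, 0 < d &
  forall h n k x y, admissible h -> (n + k)%:R * tstep h <= T ->
    k%:R * tstep h <= d -> `|x - y| <= d ->
    [/\ `|approx h (n + k) x - approx h n y| <= e, `|approx1 h (n + k) x - approx1 h n y| <= e &
        `|approx2 h (n + k) x - approx2 h n y| <= e].
Proof.
move=> T0 e e0; have [C [KC BC] HC] := approx_bounds T T0.
have C1 : 1 <= C by exact: le_trans KC.
have C0 : 0 < C by exact: lt_le_trans C1.
have lip_modulus (W D : R -> nat -> R -> R) :
    (forall h n x, is_derive x 1 (W h n) (D h n x)) ->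
    (forall h n x, admissible h -> n%:R * tstep h <= T -> `|D h n x| <= C) ->
    forall e, 0 < e -> exists2 d : R, 0 < d & forall h n x y, admissible h ->
    n%:R * tstep h <= T -> `|x - y| <= d -> `|W h n x - W h n y| <= e.
  move=> dW DC a a0; exists (a / C); first by rewrite divr_gt0.
  move=> h n x y hK nT xy; rewrite -(@divfK _ C _ a) ?gt_eqF// mulrC.
  apply: le_trans (ler_wpM2l (ltW C0) xy).
  by apply: (@lipschitz_derive _ _ (D h n)) => // z; exact: DC.
have C20 : 0 <= K * C + K * C ^+ 2.
  by rewrite addr_ge0// mulr_ge0// ?exprn_ge0// ltW.
have stepE h n (u w r : R -> R) x : u x = avg h w x + tstep h * r x ->
    `|r x| <= K * C + K * C ^+ 2 -> `|u x - avg h w x| <= tstep h * (K * C + K * C ^+ 2).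
  move=> -> rC; rewrite addrAC subrr add0r normrM ger0_norm ?tstep_ge0//.
  by rewrite ler_wpM2l// tstep_ge0.
have KC2 : K <= K * C + K * C ^+ 2.
  have := ler_peMr K0 C1; have : 0 <= K * C ^+ 2 by rewrite mulr_ge0// sqr_ge0.
  lra.
pose time_modulus (W : R -> nat -> R -> R) := forall e, 0 < e ->
  exists2 d : R, 0 < d & forall h n k x y, admissible h ->
  (n + k)%:R * tstep h <= T -> k%:R * tstep h <= d -> `|x - y| <= d ->
  `|W h (n + k)%N x - W h n y| <= e.
have M0 : time_modulus approx.
  apply: (@evolution_modulus approx T C (K * C + K * C ^+ 2) (ltW C0) C20).
- move=> h n x hK nT; rewrite ger0_norm; have := approx_01 h hK n x; lra.
- move=> h n x hK nT; apply: (stepE h n (approx h n.+1) _ (fun x => g (approx h n x))) => //.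
  by apply: le_trans KC2; apply: g_le; exact: approx_01.
- apply: (lip_modulus approx approx1) => h n x; first exact: (is_derive_approx h n x).1.
  by move=> hK nT; exact: (HC h n x hK nT).1.
have M1 : time_modulus approx1.
  apply: (@evolution_modulus approx1 T C (K * C + K * C ^+ 2) (ltW C0) C20).
- by move=> h n x hK nT; exact: (HC h n x hK nT).1.
- move=> h n x hK nT.
  apply: (stepE h n (approx1 h n.+1) _ (fun x => g1 (approx h n x) * approx1 h n x)) => //.
  rewrite (@le_trans _ _ (K * C))//; last by rewrite lerDl mulr_ge0// sqr_ge0.
  by rewrite normrM ler_pM// (HC h n x hK nT).1.
- apply: (lip_modulus approx1 approx2) => h n x; first exact: (is_derive_approx h n x).2.
  by move=> hK nT; exact: (HC h n x hK nT).2.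
have M2 : time_modulus approx2.
  apply: (@evolution_modulus approx2 T C (K * C + K * C ^+ 2) (ltW C0) C20).
- by move=> h n x hK nT; exact: (HC h n x hK nT).2.
- move=> h n x hK nT; have [q p] := HC h n x hK nT.
  apply: (stepE h n (approx2 h n.+1) _
    (fun x => g1 (approx h n x) * approx2 h n x + g2 (approx h n x) * approx1 h n x ^+ 2)) => //.
  rewrite (le_trans (ler_normD _ _))// lerD// normrM ler_pM//.
  by rewrite normrX lerXn2r// nnegrE ltW.
- exact: approx2_modulus.
have [[d0 d00 H0] [d1 d10 H1] [d2 d20 H2]] := And3 (M0 _ e0) (M1 _ e0) (M2 _ e0).
exists (Num.min d0 (Num.min d1 d2)); first by rewrite !lt_min d00 d10.
move=> h n k x y hK nkT; rewrite !le_min => /and3P[k0 k1 k2] /and3P[x0 x1 x2].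
by split; [exact: H0|exact: H1|exact: H2].
Qed.

(** By induction on [k], one step adds an error of at most [tstep h * e], in three thirds: the
    second difference against [approx2], the drift of [approx2] since step [n], and the drift of
    [g (approx)] since step [n]. *)
Lemma approx_consistency T : 0 <= T -> forall e, 0 < e -> exists2 d : R, 0 < d &
  forall h n k x, admissible h -> 0 <= h <= d -> (n + k)%:R * tstep h <= T ->
    k%:R * tstep h <= d ->
    `|approx h (n + k) x - approx h n x - k%:R * tstep h * (approx2 h n x + g (approx h n x))|
      <= k%:R * tstep h * e.
Proof.
move=> T0 e e0; have K30 : 0 < e / (3 * K).
  by rewrite divr_gt0// mulr_gt0// (lt_le_trans _ K1).
have [d d0 Hd] := approx_modulus T T0 _ K30.
exists d => // h n k x hK /andP[h0 hd]; have t0 := tstep_ge0 h.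
have eK : e / (3 * K) * K = e / 3.
  by rewrite invfM mulrA divfK// gt_eqF// (lt_le_trans _ K1).
have eK3 : e / (3 * K) <= e / 3 by rewrite -eK ler_peMr// ltW.
elim: k => [|k IH] nkT kd; first by rewrite addn0 !mul0r subr0 subrr normr0.
have nkT' : (n + k)%:R * tstep h <= T.
  by apply: le_trans nkT; rewrite ler_wpM2r// ler_nat addnS.
have kd' : k%:R * tstep h <= d.
  by apply: le_trans kd; rewrite ler_wpM2r// ler_nat.
have {}IH := IH nkT' kd'.
have [M0 _ M2] := Hd h n k x x hK nkT' kd' ltac:(by rewrite subrr normr0 ltW).
have sd : `|approx h (n + k) (x + h) + approx h (n + k) (x - h) - 2 * approx h (n + k) x
    - approx2 h (n + k) x * h ^+ 2| <= e / 3 * h ^+ 2.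
  apply: (@second_difference _ _ (approx1 h (n + k))) => // z.
  - exact: (is_derive_approx h (n + k) z).1.
  - exact: (is_derive_approx h (n + k) z).2.
  - move=> zh; apply: le_trans eK3.
    have [|||_ _] := Hd h (n + k)%N 0%N z x hK; rewrite ?addn0 ?mul0r//.
    + exact: ltW.
    + exact: le_trans hd.
have gm : `|g (approx h (n + k) x) - g (approx h n x)| <= e / 3.
  by rewrite -eK mulrC (le_trans (g_lip _ _))// ler_wpM2l.
have -> : approx h (n + k.+1) x =
    avg h (approx h (n + k)) x + tstep h * g (approx h (n + k) x).
  by rewrite addnS /approx /iterate iterS.
rewrite -natr1; have {}M2 := le_trans M2 eK3.
move: IH sd gm M2; rewrite /avg /tstep.
set h2 := h ^+ 2.
set u' := approx h (n + k) x; set u := approx h n x; set p' := approx2 h (n + k) x.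
set p := approx2 h n x; set q := approx h (n + k) (x + h); set r := approx h (n + k) (x - h).
move=> IH sd gm M2.
have h20 : 0 <= h2 by exact: sqr_ge0.
have M2' : `|h2 * (p' - p)| <= h2 * (e / 3) by rewrite normrM ger0_norm// ler_wpM2l.
have gm' : `|h2 * (g u' - g u)| <= h2 * (e / 3) by rewrite normrM ger0_norm// ler_wpM2l.
move: IH sd M2' gm'; rewrite !ler_norml; lra.
Qed.

(** The lower bound accompanies the constructed solution: a function that is a discrete subsolution
    for all small meshes lies below all fine enough approximations, hence below their limit. *)
Theorem cauchy_solution_exists f : (forall x, 0 <= x <= 1 -> f x = g x) ->
  exists2 u, cauchy_solution f v u & forall w h0, 0 < h0 ->
    (forall h x, 0 < h <= h0 -> w x <= scheme g h w x) ->
    (forall x, w x <= v x) -> forall t x, w x <= u t x.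
Proof.
(* Both [hs m <= 1] and [hs m * K <= 1] hold, which makes every mesh size admissible. *)
move=> fg; pose hs (m : nat) : R := m.+1%:R^-1 / K; pose tau (m : nat) := tstep (hs m).
have K00 : 0 < K by exact: lt_le_trans K1.
have hs0 (m : nat) : 0 < hs m by rewrite divr_gt0// invr_gt0.
have hs_le (m : nat) : hs m <= m.+1%:R^-1 by rewrite ler_piMr// invf_le1.
have m1 (m : nat) : m.+1%:R^-1 <= 1 :> R by rewrite invf_le1// ler1n.
have hsK (m : nat) : hs m * K <= 1 by rewrite divfK ?gt_eqF.
have hs1 (m : nat) : hs m <= 1 by exact: le_trans (m1 m).
have tau_hs (m : nat) : tau m <= hs m.
  rewrite /tau /tstep expr2; have := ler_piMr (ltW (hs0 m)) (hs1 m).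
  have := hs0 m; lra.
have hs_cvg e : 0 < e -> \forall m \near \oo, hs m <= e.
  move=> e0; near=> m; apply: le_trans (hs_le m) _; apply/ltW; near: m.
  exact: (near_infty_natSinv_lt (PosNum e0)).
have adm (m : nat) : admissible (hs m).
  rewrite /admissible /tstep expr2.
  have := ler_pM (ltW (hs0 m)) (mulr_ge0 (ltW (hs0 m)) K0) (hs1 m) (hsK m).
  lra.
have [F [FU Foo]] := @ultraFilterLemma _ _ eventually_filter.
exists (ulim tau F (fun m : nat => approx (hs m))).
- apply: (@ulim_cauchy_solution R g K tau (fun m : nat => approx (hs m))
    (fun m : nat => approx1 (hs m)) (fun m : nat => approx2 (hs m))) => //.
  + exact: g_lip.
  + by move=> m; rewrite /tau /tstep divr_gt0// exprn_gt0.
  + by move=> e /hs_cvg; apply: filterS => m; exact: le_trans.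
  + by move=> m n x; exact: (approx_01 _ (adm m)).
  + move=> T T0; have [C _ HC] := approx_bounds T T0; exists C => m n x.
    by apply: HC; exact: adm.
  + by move=> m n x; exact: (is_derive_approx _ _ _).1.
  + by move=> m n x; exact: (is_derive_approx _ _ _).2.
  + move=> T T0 e e0; have [d d0 Hd] := approx_modulus T T0 e e0.
    by exists d => // m n k x y; apply: Hd; exact: adm.
  + move=> T T0 e e0; have [d d0 Hd] := approx_consistency T T0 e e0.
    exists d => //; have := hs_cvg d d0; apply: filterS => m md n k x.
    by apply: Hd; [exact: adm|rewrite ltW].
- move=> w h0 h00 ww wv t x.
  apply: (@ulim_ge R tau (fun m : nat => approx (hs m))) => //.
  + by move=> m n y; exact: (approx_01 _ (adm m)).
  + have := hs_cvg h0 h00; apply: filterS => m mh n y.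
    by apply: (approx_ge _ (adm m)) => // z; apply: ww; rewrite hs0.
Unshelve. all: by end_near. Qed.

End iterates.

(** * The ground state *)

Section positive_solution.
Context {R : realType}.
Implicit Types (W : R -> R) (x y z K e h : R).

(* Otherwise [W1 + K W] starts negative and, since it satisfies [y' <= K y],
   stays so; then W decreases at least linearly and changes sign. *)
Lemma positive_derive_ge W (W1 W2 : R -> R) K : 1 <= K ->
  (forall x, is_derive x 1 W (W1 x)) -> (forall x, is_derive x 1 W1 (W2 x)) ->
  (forall x, 0 < W x) -> (forall x, `|W2 x| <= K * W x) ->
  forall x, - (K * W x) <= W1 x.
Proof.
move=> K1 dW dW1 W0 W2K a; rewrite leNgt; apply/negP => Wa.
pose y0 := W1 a + K * W a; have y00 : y0 < 0 by rewrite /y0; lra.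
have K0 : 0 < K by exact: lt_le_trans K1.
have y_le x : a <= x -> W1 x + K * W x <= y0.
  move=> ax; pose G x := - ((W1 x + K * W x) * expR (- K * (x - a))).
  pose G1 x := expR (- K * (x - a)) * (K ^+ 2 * W x - W2 x).
  have Gax : G a <= G x.
    apply: (@nondecreasing_derive _ G G1) => // z _.
      have dWz := dW z; have dW1z := dW1 z.
      by rewrite /G /G1; apply: is_derive_eq; rewrite /GRing.scale/=; ring.
    rewrite mulr_ge0 ?expR_ge0// subr_ge0.
    rewrite (le_trans (ler_norm _))// (le_trans (W2K z))//.
    by rewrite ler_pM2r// expr2 ler_peMl// ltW.
  move: Gax; rewrite /G subrr mulr0 expR0 mulr1 lerN2 -/y0 => Gax.
  have E1 : 0 < expR (- K * (x - a)) <= 1.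
    rewrite expR_gt0 -expR0 ler_expR mulNr oppr_le0 mulr_ge0 ?(ltW K0)//.
    by rewrite subr_ge0.
  rewrite -(ler_pM2r (andP E1).1) (le_trans Gax)//.
  by rewrite ler_niMr ?(ltW y00)// (andP E1).2.
pose b := a + W a / - y0.
have ab : a <= b by rewrite lerDl divr_ge0 ?ltW// oppr_gt0.
have : W b <= W a + y0 * (b - a).
  pose H x := y0 * x - W x.
  have : H a <= H b.
    apply: (@nondecreasing_derive _ H (fun x => y0 - W1 x)) => // z /andP[az _].
      have dWz := dW z.
      by rewrite /H; apply: is_derive_eq; rewrite /GRing.scale/=; ring.
    by have := y_le z az; have := mulr_gt0 K0 (W0 z); lra.
  by rewrite /H; lra.
have -> : y0 * (b - a) = - W a.
  by rewrite /b addrAC subrr add0r invrN mulrN mulrN mulrC divfK// lt_eqF.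
by rewrite subrr leNgt W0.
Qed.

Lemma positive_derive_abs W (W1 W2 : R -> R) K : 1 <= K ->
  (forall x, is_derive x 1 W (W1 x)) -> (forall x, is_derive x 1 W1 (W2 x)) ->
  (forall x, 0 < W x) -> (forall x, `|W2 x| <= K * W x) ->
  forall x, `|W1 x| <= K * W x.
Proof.
move=> K1 dW dW1 W0 W2K x; rewrite ler_norml.
rewrite (positive_derive_ge W W1 W2)//=.
(* The upper bound is the lower bound for the reflected function [W (- z)]. *)
have dN y : is_derive y 1 (fun z : R => - z) (- 1).
  by apply: is_derive_eq.
have dV y : is_derive y 1 (fun z => W (- z)) (- W1 (- y)).
  have dWy := dW (- y); have := @is_derive1_comp _ W -%R y _ _ dWy (dN y).
  by rewrite mulrN1.
have dV1 y : is_derive y 1 (fun z => - W1 (- z)) (W2 (- y)).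
  have dWy := dW1 (- y); have dc := @is_derive1_comp _ W1 -%R y _ _ dWy (dN y).
  have := is_deriveN dc.
  by rewrite mulrN1 opprK.
have := @positive_derive_ge (fun z => W (- z)) _ _ K K1 dV dV1.
move=> /(_ (fun _ => W0 _) (fun _ => W2K _) (- x)).
by rewrite opprK lerN2.
Qed.

(** The bound on the logarithmic derivative makes [W z * expR (K * z)] nondecreasing and
    [W z * expR (- K * z)] nonincreasing. *)
Lemma harnack W (W1 : R -> R) K : 0 <= K -> (forall x, is_derive x 1 W (W1 x)) ->
  (forall x, 0 < W x) -> (forall x, `|W1 x| <= K * W x) ->
  forall x y, W x * expR (- K * `|x - y|) <= W y.
Proof.
move=> K0 dW W0 W1K x y; have [xy|/ltW yx] := leP x y.
- pose G z := W z * expR (K * z).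
  have : G x <= G y.
    apply: (@nondecreasing_derive _ G (fun z => expR (K * z) * (W1 z + K * W z))) => //.
      move=> z _; have dWz := dW z.
      by rewrite /G; apply: is_derive_eq; rewrite /GRing.scale/=; ring.
    move=> z _; rewrite mulr_ge0 ?expR_ge0//.
    by have := W1K z; rewrite ler_norml; lra.
  rewrite /G => Gxy; rewrite -(ler_pM2r (expR_gt0 (K * y))).
  rewrite (le_trans _ Gxy)// -mulrA -expRD distrC ger0_norm ?subr_ge0//.
  by rewrite ler_pM2l// ler_expR; lra.
- pose G z := - (W z * expR (- K * z)).
  have : G y <= G x.
    apply: (@nondecreasing_derive _ G (fun z => expR (- K * z) * (K * W z - W1 z))) => //.
      move=> z _; have dWz := dW z.
      by rewrite /G; apply: is_derive_eq; rewrite /GRing.scale/=; ring.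
    move=> z _; rewrite mulr_ge0 ?expR_ge0//.
    by have := W1K z; rewrite ler_norml; lra.
  rewrite /G lerN2 => Gxy; rewrite -(ler_pM2r (expR_gt0 (- K * y))).
  rewrite (le_trans _ Gxy)// -mulrA -expRD ger0_norm ?subr_ge0//.
  by rewrite ler_pM2l// ler_expR; lra.
Qed.

End positive_solution.

(** * Integrable positive functions on the line *)

Section integrable_functions.
Context {R : realType}.
Local Notation mu := (@lebesgue_measure R).
Implicit Types (W : R -> R) (x y z K e h a b : R).

Lemma Rintegral_subset W (A B : set R) : measurable A -> measurable B -> A `<=` B ->
  mu.-integrable B (EFin \o W) -> (forall x, 0 <= W x) ->
  \int[mu]_(x in A) W x <= \int[mu]_(x in B) W x.
Proof.
move=> mA mB AB iW W0; have iA : mu.-integrable A (EFin \o W) by exact: integrableS iW.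
rewrite /Rintegral fine_le//; try exact: integrable_fin_num.
by apply: ge0_subset_integral => //; [case/integrableP : iW|move=> x _; rewrite lee_fin].
Qed.

Lemma integral_segment_cvg W : mu.-integrable setT (EFin \o W) -> (forall x, 0 <= W x) ->
  forall e, 0 < e -> exists n : nat,
  \int[mu]_x W x - e <= \int[mu]_(x in `[- n%:R, n%:R]) W x.
Proof.
move=> iW W0 e e0.
have mW := (integrableP _ _ _ iW).1.
pose F (n : nat) : set R := `[- n%:R, n%:R]%classic.
have UF : \bigcup_i F i = setT.
  rewrite -subTset => x _; exists (Num.truncn `|x|).+1 => //.
  rewrite /F /= in_itv/= -ler_norml ltW//; exact: truncnS_gt.
have cF : \int[mu]_(x in F i) W x @[i --> \oo] --> \int[mu]_x W x.
  apply: fine_cvg; rewrite -UF fineK.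
  - apply: ge0_nondecreasing_set_cvg_integral => //.
    + move=> i j ij; apply/subsetPset => x; rewrite /F /= !in_itv/=.
      move=> /andP[xi xj]; have : i%:R <= j%:R :> R by rewrite ler_nat.
      by move=> ij'; apply/andP; split; lra.
    + by move=> i; exact: measurable_itv.
    + by move=> i; apply: measurable_funS mW.
    + by move=> i x _; rewrite lee_fin.
  - by rewrite UF; exact: integrable_fin_num.
have /cvgrPdist_le/(_ e e0)[n _ Hn] := cF; exists n.
have := Hn n (leqnn n); rewrite ler_norml => /andP[_].
by rewrite lerBlDr addrC lerBlDl addrC.
Qed.

(** A value [W x > e] far away would force, by the Harnack inequality, a mass above [e * expR (- K)]
    on a unit interval next to [x], more than what is left outside [[- n, n]]. *)
Lemma vanishing_at_infinity W K : mu.-integrable setT (EFin \o W) ->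
  (forall x, 0 < W x) -> 0 <= K ->
  (forall x y, W x * expR (- K * `|x - y|) <= W y) ->
  forall e, 0 < e -> exists X : R, forall x, X <= `|x| -> W x <= e.
Proof.
move=> iW W0 K0 HW e e0.
have c0 : 0 < expR (- K) by exact: expR_gt0.
have [n Hn] := integral_segment_cvg W iW (fun x => ltW (W0 x)) _ (mulr_gt0 e0 c0).
exists (n%:R + 1) => x nx.
(* The unit interval extends from [x] away from the origin. *)
have [b xb nb] : exists2 b, b <= x <= b + 1 &
    [disjoint `[- n%:R, n%:R]%classic & `[b, b + 1]%classic : set R].
  have n0 := ler0n R n.
  have [x0|x0] := leP 0 x.
    exists x; first lra.
    rewrite disj_set2E; apply/eqP; rewrite -subset0 => z /= [].
    by rewrite !in_itv/= => z1 z2; move: nx; rewrite ger0_norm//; lra.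
  exists (x - 1); first lra.
  rewrite disj_set2E; apply/eqP; rewrite -subset0 => z /= [].
  by rewrite !in_itv/= => z1 z2; move: nx; rewrite ltr0_norm//; lra.
have mA : measurable (`[- n%:R, n%:R]%classic : set R) by exact: measurable_itv.
have mB : measurable (`[b, b + 1]%classic : set R) by exact: measurable_itv.
have iB : mu.-integrable `[b, b + 1] (EFin \o W) by exact: integrableS iW.
have IB : W x * expR (- K) <= \int[mu]_(z in `[b, b + 1]) W z.
  have -> : W x * expR (- K) = \int[mu]_(z in `[b, b + 1]) (cst (W x * expR (- K))) z.
    rewrite Rintegral_cst//.
    suff -> : fine (mu ([set` `[b, b + 1]%R] : set R)) = 1 by rewrite mulr1.
    by rewrite lebesgue_measure_itv/= lte_fin ltrDl ltr01 -EFinB/= addrAC subrr add0r.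
  apply: le_Rintegral => //.
    apply: continuous_compact_integrable; first exact: segment_compact.
    by move=> z; exact: cvg_cst.
  move=> z; rewrite /= in_itv/= => zb; apply: le_trans (HW x z).
  rewrite ler_pM2l// ler_expR mulNr lerN2 ler_piMr// ler_norml; lra.
have := Rintegral_subset W _ _ (measurableU _ _ mA mB) measurableT (@subsetT _ _) iW
  (fun x => ltW (W0 x)).
rewrite Rintegral_setU//; last by apply: integrableS iW => //; exact: measurableU.
move=> H; have : W x * expR (- K) <= e * expR (- K) by lra.
by rewrite ler_pM2r.
Qed.

End integrable_functions.

(** * The stationary subsolution *)

Section ground_state.
Context {R : realType}.
Implicit Types (x y z h e s eta gam eps : R).

Variables (g g1 g2 : R -> R) (K : R).
Hypothesis dg : forall x, is_derive x 1 g (g1 x).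
Hypothesis dg1 : forall x, is_derive x 1 g1 (g2 x).
Hypothesis K1 : 1 <= K.
Hypothesis g1K : forall x, `|g1 x| <= K.
Hypothesis g2K : forall x, `|g2 x| <= K.
Hypothesis g_0 : g 0 = 0.
Hypothesis g_1 : g 1 = 0.

Variables W W1 : R -> R.
Hypothesis dW : forall x, is_derive x 1 W (W1 x).
Hypothesis dW1 : forall x, is_derive x 1 W1 (- g (W x)).
Hypothesis W01 : forall x, 0 < W x <= 1.
Hypothesis W_vanish : forall e, 0 < e -> exists X : R, forall x, X <= `|x| -> W x <= e.

Let K0 : 0 < K. Proof. exact: lt_le_trans K1. Qed.
Let W0 x : 0 < W x. Proof. by have /andP[] := W01 x. Qed.
Let W_le1 x : W x <= 1. Proof. by have /andP[] := W01 x. Qed.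
Let gL x y : `|g x - g y| <= K * `|x - y|. Proof. exact: lipschitz_derive. Qed.
Let g1L x y : `|g1 x - g1 y| <= K * `|x - y|. Proof. exact: lipschitz_derive. Qed.

Lemma gW_le x : `|g (W x)| <= K * W x.
Proof. by have := gL (W x) 0; rewrite g_0 !subr0 (ger0_norm (ltW (W0 x))). Qed.

Lemma W1_le x : `|W1 x| <= K * W x.
Proof.
apply: (@positive_derive_abs R W W1 (fun x => - g (W x)) K) => // y.
by rewrite normrN gW_le.
Qed.

Lemma W1_leK x : `|W1 x| <= K.
Proof. by rewrite (le_trans (W1_le x))// ler_piMr// ltW. Qed.

Lemma W_harnack x y : W x * expR (- K * `|x - y|) <= W y.
Proof. by apply: (@harnack R W W1) => //; [exact: ltW|exact: W1_le]. Qed.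

Lemma W_lip x y : `|W x - W y| <= K * `|x - y|.
Proof. by apply: (@lipschitz_derive R W W1) => // z; exact: W1_leK. Qed.

(** Far out [W] is below [W 0 / 2], so the maximum over a large segment is global. *)
Lemma W_max_exists : exists x0, forall x, W x <= W x0.
Proof.
have W00 : 0 < W 0 / 2 by rewrite divr_gt0.
have [X HX] := W_vanish _ W00.
have X0 : - (`|X| + 1) <= `|X| + 1 by have := normr_ge0 X; lra.
have [|c cX Hc] := @EVT_max R W (- (`|X| + 1)) (`|X| + 1) X0.
  by apply: continuous_subspaceT => x; exact: is_derive_continuous (dW x).
exists c => x; have [xX|Xx] := leP `|x| (`|X| + 1).
  by apply: Hc; rewrite in_itv/= -ler_norml.
have /HX Wx : X <= `|x| by have := ler_norm X; lra.
have : W 0 <= W c by apply: Hc; rewrite in_itv/=; have := normr_ge0 X; lra.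
by move: W00; lra.
Qed.

Variable x0 : R.
Hypothesis W_max : forall x, W x <= W x0.

Lemma W1_max : W1 x0 = 0.
Proof.
apply/eqP/negPn/negP => W10; pose a := `|W1 x0|.
have a0 : 0 < a by rewrite normr_gt0.
have a20 : 0 < a / 2 by rewrite divr_gt0.
have /is_derive_epsP/(_ _ a20)[r r0 Hr] := dW x0.
pose y := x0 + Num.sg (W1 x0) * r.
have yx0 : `|y - x0| = r.
  by rewrite /y addrAC subrr add0r normrM normr_sg W10 mul1r gtr0_norm.
have := Hr y; rewrite yx0 => /(_ (lexx _)).
have -> : W1 x0 * (y - x0) = a * r.
  by rewrite /y addrAC subrr add0r mulrA (mulrC _ (Num.sg _)) -normrEsg.
have := W_max y; have := mulr_gt0 a0 r0; rewrite ler_norml; lra.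
Qed.

Lemma g_max_ge0 : 0 <= g (W x0).
Proof.
rewrite leNgt; apply/negP => gm; pose q := - g (W x0) / 2.
have q0 : 0 < q by rewrite /q; lra.
have K20 : 0 < K ^+ 2 by rewrite exprn_gt0.
(* The function [g (W z)] is Lipschitz with constant [K ^+ 2], so within this [h] the second
   derivative of [W], equal to [2 * q] at [x0], stays above [q]; this contradicts maximality. *)
pose h := q / K ^+ 2; have h0 : 0 < h by rewrite divr_gt0.
have hq : K ^+ 2 * h = q by rewrite mulrC divfK// gt_eqF.
have : q * h ^+ 2 <= W (x0 + h) + W (x0 - h) - 2 * W x0.
  apply: (@second_difference_ge R W W1 (fun x => - g (W x))) => //; first exact: ltW.
  move=> z zh; have zx : `|z - x0| <= h by rewrite ler_norml; lra.
  have := le_trans (gL (W z) (W x0)) (ler_wpM2l (ltW K0) (W_lip z x0)).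
  rewrite mulrA -expr2 => /le_trans/(_ (ler_wpM2l (ltW K20) zx)).
  by rewrite hq ler_norml /q; lra.
have := W_max (x0 + h); have := W_max (x0 - h).
have : 0 < q * h ^+ 2 by rewrite mulr_gt0// exprn_gt0.
lra.
Qed.

(* If [g] vanished at [W x0], uniqueness for the ODE would make [W] constant. *)
Lemma g_max_gt0 : 0 < g (W x0).
Proof.
rewrite lt_neqAle g_max_ge0 andbT eq_sym; apply/negP => /eqP gm.
(* The squared distance to the equilibrium [(W x0, 0)] in the phase plane grows at rate at most
   [1 + K]. It vanishes at [x0], hence to the right of [x0], against the decay of [W]. *)
pose G x := - (((W x - W x0) ^+ 2 + W1 x ^+ 2) * expR (- (1 + K) * (x - x0))).
have Gx x : x0 <= x -> G x0 <= G x.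
  move=> x0x; apply: (@nondecreasing_derive _ G (fun x => expR (- (1 + K) * (x - x0)) *
    ((1 + K) * ((W x - W x0) ^+ 2 + W1 x ^+ 2)
      - 2 * (W x - W x0) * W1 x + 2 * W1 x * g (W x)))) => // z _.
    have dWz := dW z; have dW1z := dW1 z.
    by rewrite /G; apply: is_derive_eq; rewrite /GRing.scale/=; ring.
  rewrite mulr_ge0 ?expR_ge0//.
  have := gL (W z) (W x0); rewrite gm subr0.
  set a := W z - W x0; set b := W1 z; set c := g (W z) => ca.
  have ab : 2 * (`|a| * `|b|) <= a ^+ 2 + b ^+ 2.
    rewrite -(real_normK (num_real a)) -(real_normK (num_real b)).
    by have := sqr_ge0 (`|a| - `|b|); rewrite sqrrB; lra.
  have ab1 : a * b <= `|a| * `|b| by rewrite -normrM ler_norm.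
  have bc : - (b * c) <= K * (`|a| * `|b|).
    rewrite (le_trans (ler_norm _))// normrN normrM mulrC mulrA ler_wpM2r//.
  have := ler_wpM2l (ltW K0) ab; lra.
have [|X HX] := W_vanish (W x0 / 2); first by rewrite divr_gt0.
pose x := `|X| + `|x0|.
have x0x : x0 <= x by have := ler_norm x0; have := normr_ge0 X; rewrite /x; lra.
have /HX Wx : X <= `|x|.
  by have := ler_norm X; have := normr_ge0 x0; have := ler_norm x; rewrite /x; lra.
have := Gx x x0x; rewrite /G subrr W1_max expr0n/= addr0 mul0r oppr0 oppr_ge0.
rewrite pmulr_lle0 ?expR_gt0// => H.
have : 0 < (W x - W x0) ^+ 2.
  by rewrite exprn_even_gt0//= subr_eq0 lt_eqF//; have := W0 x0; lra.
by have := sqr_ge0 (W1 x); lra.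
Qed.

(** The strict inequality leaves room for the competitor, bounded by a multiple of [W] slightly
    larger than [W], to stay below 1. *)
Lemma W_max_lt1 : W x0 < 1.
Proof.
rewrite lt_neqAle W_le1 andbT; apply/negP => /eqP E.
by have := g_max_gt0; rewrite E g_1 ltxx.
Qed.

(** The branch meant for [s * (x - x0) >= 0]. The next two definitions are its derivatives, with W''
    replaced by [- g (W x)]. *)
Definition perturbation s eta gam eps x :=
  W x + eps * (- s * W1 x + eta * expR (- (s * (2 * K) * (x - x0))) - gam).

Definition perturbation1 s eta eps x :=
  W1 x + eps * (s * g (W x) - s * eta * (2 * K) * expR (- (s * (2 * K) * (x - x0)))).

Definition perturbation2 s eta eps x := - g (W x) + eps *
  (s * g1 (W x) * W1 x + eta * (2 * K) ^+ 2 * expR (- (s * (2 * K) * (x - x0)))).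

Lemma is_derive_perturbation s eta gam eps x :
  is_derive x 1 (perturbation s eta gam eps) (perturbation1 s eta eps x).
Proof.
have dWx := dW x; have dW1x := dW1 x.
rewrite /perturbation /perturbation1; apply: is_derive_eq.
by rewrite /GRing.scale/=; ring.
Qed.

Lemma is_derive_perturbation1 s eta eps x : s ^+ 2 = 1 ->
  is_derive x 1 (perturbation1 s eta eps) (perturbation2 s eta eps x).
Proof.
move=> s2; have dWx := dW x; have dW1x := dW1 x.
have dgW : is_derive x 1 (fun y => g (W y)) (g1 (W x) * W1 x).
  exact: is_derive1_comp.
rewrite /perturbation1 /perturbation2; apply: is_derive_eq.
rewrite (_ : eta * (2 * K) ^+ 2 = s ^+ 2 * (eta * (2 * K) ^+ 2)); last first.
  by rewrite s2 mul1r.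
by rewrite /GRing.scale/=; ring.
Qed.

(** * Parameters of the perturbation and the glued subsolution *)

Section perturbed.
(** Outside the core of radius [X] the linearization has potential at most [- c]. The value of [gam]
    is that of the exponential term at distance [X], so this term is at least [gam] in the core.
    [eta_kink] makes the kink at [x0] convex, [H] bounds the perturbing function, and [epsH]
    controls its quadratic effect. *)
Variables (c X eta gam eps : R).
Hypothesis X0 : 0 <= X.
Let E := expR (1 : R).
Let H := K + E + 1.
Hypothesis c0 : 0 < c <= K.
Hypothesis g1W : forall x, X <= `|x - x0| -> g1 (W x) <= - c.
Hypothesis eta01 : 0 < eta <= 1.
Hypothesis eta_kink : eta * (4 * K * E) <= g (W x0).
Hypothesis gamE : gam = eta * expR (- (2 * K * X)).
Hypothesis eps01 : 0 < eps <= 1.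
Hypothesis epsH : eps * (K * H ^+ 2) <= gam * c / 2.

Let eta0 : 0 < eta. Proof. by have /andP[] := eta01. Qed.
Let eps0 : 0 < eps. Proof. by have /andP[] := eps01. Qed.
Let gam0 : 0 < gam. Proof. by rewrite gamE mulr_gt0// expR_gt0. Qed.
Let gam_eta : gam <= eta.
Proof.
rewrite gamE ler_piMr// ?(ltW eta0)// -expR0 ler_expR oppr_le0.
by rewrite !mulr_ge0// ltW.
Qed.
Let gam1 : gam <= 1.
Proof. by rewrite (le_trans gam_eta)//; have /andP[] := eta01. Qed.
Let E1 : 1 <= E. Proof. by rewrite /E expR_ge1. Qed.

(** The lower bound [- 1] allows points slightly beyond [x0], which the scheme reaches from the
    half-line. *)
Lemma perturbation_strict s x : `|s| = 1 -> - 1 <= s * (2 * K) * (x - x0) ->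
  eps * (gam * c / 2) <= perturbation2 s eta eps x + g (perturbation s eta gam eps x).
Proof.
move=> s1 sx; set psi := expR (- (s * (2 * K) * (x - x0))).
have psiE : psi <= E by rewrite ler_expR; lra.
have psi0 : 0 < psi by exact: expR_gt0.
have etapsi : 0 < eta * psi by rewrite mulr_gt0.
have etapsiE : eta * psi <= E.
  by rewrite (le_trans _ psiE)// ler_piMl ?(ltW psi0)//; have /andP[] := eta01.
(* In the tails [- gam * g1 (W x)] alone gives [gam * c]; in the core [eta * psi >= gam]. In both
   cases the factor [(2 * K) ^+ 2] outweighs [g1]. *)
have linear : gam * c <= eta * (2 * K) ^+ 2 * psi + g1 (W x) * (eta * psi - gam).
  have := g1K (W x); rewrite ler_norml => /andP[gK _].
  have K2 : K <= K ^+ 2 by rewrite expr2 ler_peMl// ltW.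
  have K2psi : K * (eta * psi) <= K ^+ 2 * (eta * psi) by rewrite ler_pM2r.
  have /andP[c00 cK] := c0.
  have [xX|Xx] := leP X `|x - x0|.
    have gc := g1W x xX.
    have t1 : - K * (eta * psi) <= g1 (W x) * (eta * psi) by rewrite ler_pM2r.
    have t2 : g1 (W x) * gam <= - c * gam by rewrite ler_pM2r.
    by have := mulr_ge0 (ltW K0) (ltW etapsi); lra.
  have gpsi : gam <= eta * psi.
    rewrite gamE ler_pM2l// ler_expR lerN2.
    have : s * (x - x0) <= X.
      by rewrite (le_trans (ler_norm _))// normrM s1 mul1r ltW.
    by move=> /(ler_wpM2l (ltW K0)); lra.
  have t1 : - K * (eta * psi - gam) <= g1 (W x) * (eta * psi - gam).
    by rewrite ler_wpM2r// subr_ge0.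
  have t2 : gam * c <= gam * K by rewrite ler_pM2l.
  have t3 : gam * K <= (eta * psi) * K by rewrite ler_pM2r.
  by have := mulr_ge0 (ltW K0) (ltW gam0); lra.
set h := - s * W1 x + eta * psi - gam.
have hH : `|h| <= H.
  have sW : `|s * W1 x| <= K by rewrite normrM s1 mul1r W1_leK.
  have aux (a b k e d : R) : `|a| <= k -> 0 < b <= e -> 0 < d <= 1 ->
      `|- a + b - d| <= k + e + 1 by rewrite !ler_norml; lra.
  by rewrite /h mulNr; apply: aux; rewrite ?etapsi ?gam0.
(* Expanding [g] at [W x] leaves a quadratic remainder, for which half of the gain is reserved. The
   terms in [g1 (W x) * W1 x] cancel at the end, since [W1] solves the linearized equation. *)
have taylor : g (W x) + g1 (W x) * (eps * h) - K * (eps * h) ^+ 2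
    <= g (perturbation s eta gam eps x).
  have -> : perturbation s eta gam eps x = W x + eps * h by [].
  have := @taylor1 R g g1 (K * `|eps * h|) (W x) (W x + eps * h) dg.
  have -> : W x + eps * h - W x = eps * h by ring.
  rewrite -mulrA -expr2 real_normK ?num_real// => /(_ _)/ler_normlP.
  have bound z : `|z - W x| <= `|eps * h| -> `|g1 z - g1 (W x)| <= K * `|eps * h|.
    by move=> zW; rewrite (le_trans (g1L _ _))// ler_pM2l.
  by move=> /(_ bound)[]; lra.
have quad : K * (eps * h) ^+ 2 <= eps * (gam * c / 2).
  have h2 : h ^+ 2 <= H ^+ 2.
    rewrite -(real_normK (num_real h)) lerXn2r ?nnegrE// (le_trans _ hH)//.
  rewrite (_ : K * (eps * h) ^+ 2 = eps * (eps * (K * h ^+ 2))); last by ring.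
  by rewrite ler_pM2l// (le_trans _ epsH)// ler_pM2l// ler_pM2l.
have := ler_wpM2l (ltW eps0) linear.
move: quad taylor; set q := K * _ ^+ 2; rewrite /perturbation2 -/psi /h; lra.
Qed.

(** [lam] bounds the slope of a branch. The three bounds in [h0] keep the exponent above [- 1], keep
    the variation of [g] along the branch below the strict gain, and keep [g (W z)] above
    [g (W x0) / 2] near [x0]. *)
Let lam := 2 * K + 2 * K * E.
Let h0 := Num.min (2 * K)^-1
  (Num.min (eps * (gam * c / 2) / (K * lam)) (g (W x0) / (2 * K ^+ 2))).

Let lam0 : 0 < lam.
Proof. by rewrite addr_gt0// !mulr_gt0// (lt_le_trans _ E1). Qed.

Let gc0 : 0 < gam * c / 2.
Proof. by rewrite divr_gt0// mulr_gt0//; have /andP[] := c0. Qed.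

Lemma perturbation_step_gt0 : 0 < h0.
Proof.
have K20 : 0 < K ^+ 2 by rewrite exprn_gt0.
rewrite !lt_min; apply/and3P; split; first by rewrite invr_gt0 mulr_gt0.
  by rewrite divr_gt0// mulr_gt0.
by rewrite divr_gt0 ?g_max_gt0// mulr_gt0.
Qed.

Lemma perturbation1_le s x : `|s| = 1 -> - 1 <= s * (2 * K) * (x - x0) ->
  `|perturbation1 s eta eps x| <= lam.
Proof.
move=> s1 sx; set psi := expR (- (s * (2 * K) * (x - x0))).
have psiE : `|psi| <= E by rewrite ger0_norm ?expR_ge0// ler_expR; lra.
rewrite (le_trans (ler_normD _ _))// normrM (gtr0_norm eps0).
have b1 : `|s * g (W x) - s * eta * (2 * K) * psi| <= K + 2 * K * E.
  rewrite (le_trans (ler_normB _ _))// lerD//.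
    by rewrite normrM s1 mul1r (le_trans (gW_le x))// ler_piMr// ltW.
  rewrite !normrM s1 mul1r (gtr0_norm eta0) (gtr0_norm K0) ger0_norm//.
  rewrite ler_pM// ?mulr_ge0 ?(ltW eta0) ?(ltW K0)//.
  by rewrite ler_piMl ?mulr_ge0 ?(ltW K0)//; have /andP[] := eta01.
have : eps * `|s * g (W x) - s * eta * (2 * K) * psi| <= 1 * (K + 2 * K * E).
  by rewrite ler_pM ?(ltW eps0)//; have /andP[] := eps01.
by have := W1_leK x; rewrite /lam; lra.
Qed.

(** On the whole stencil the strict gain pays for the variation of [g (p z)], so the second
    derivative is at least [- g (p x)] there and the second-difference bound gives the discrete
    inequality. *)
Lemma perturbation_scheme s h x : `|s| = 1 -> 0 < h <= h0 -> 0 <= s * (x - x0) ->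
  perturbation s eta gam eps x <= scheme g h (perturbation s eta gam eps) x.
Proof.
move=> s1 /andP[hp hh0] sx; set p := perturbation s eta gam eps.
have s2 : s ^+ 2 = 1 by rewrite -(real_normK (num_real s)) s1 expr1n.
move: hh0; rewrite !le_min => /and3P[h1 h2 _].
have hK : h * (2 * K) <= 1 by rewrite -ler_pdivlMr ?mulr_gt0// div1r.
have hlam : K * (lam * h) <= eps * (gam * c / 2).
  by move: h2; rewrite ler_pdivlMr ?mulr_gt0//; lra.
have near_x z : x - h <= z <= x + h -> - 1 <= s * (2 * K) * (z - x0).
  move=> zh; have : - h <= s * (z - x).
    rewrite lerNl (le_trans (ler_norm _))// normrN normrM s1 mul1r ler_norml; lra.
  have K20 : 0 <= 2 * K by rewrite mulr_ge0// ltW.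
  by move=> /(ler_wpM2l K20); have := mulr_ge0 K20 sx; lra.
have strict z (zh : x - h <= z <= x + h) : - g (p x) <= perturbation2 s eta eps z.
  have := perturbation_strict s z s1 (near_x z zh); rewrite -/p.
  suff : g (p z) - g (p x) <= K * (lam * h) by lra.
  rewrite (le_trans (ler_norm _))// (le_trans (gL _ _))// ler_pM2l//.
  have lip a b : x - h <= a -> a <= b -> b <= x + h -> `|p b - p a| <= lam * (b - a).
    move=> xa ab bx.
    have [|y yab ->] := @mean_value R p (perturbation1 s eta eps) a b ab.
      by move=> y _; exact: is_derive_perturbation.
    rewrite normrM [`|b - a|]ger0_norm ?subr_ge0// ler_wpM2r ?subr_ge0//.
    by apply: perturbation1_le => //; apply: near_x; lra.
  have [zx|xz] := leP z x.
    rewrite distrC (le_trans (lip z x _ _ _))//; try lra.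
    by rewrite ler_wpM2l ?(ltW lam0)//; lra.
  rewrite (le_trans (lip x z _ _ _))//; try lra.
  by rewrite ler_wpM2l ?(ltW lam0)//; lra.
have := @second_difference_ge R p (perturbation1 s eta eps)
  (perturbation2 s eta eps) (- g (p x)) x h (ltW hp)
  (fun z _ => is_derive_perturbation s eta gam eps z)
  (fun z _ => is_derive_perturbation1 s eta eps z s2) strict.
by rewrite /scheme /avg /tstep; lra.
Qed.

(* The branch that is not selected on one side of [x0] is the smaller one near
   [x0]: the glued function has a convex kink there. *)
Lemma perturbation_kink s y : `|s| = 1 -> 0 <= y <= h0 ->
  perturbation s eta gam eps (x0 - s * y) <=
  perturbation (- s) eta gam eps (x0 - s * y).
Proof.
move=> s1 /andP[y0]; rewrite !le_min => /and3P[yK _ yg].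
have s2 : s ^+ 2 = 1 by rewrite -(real_normK (num_real s)) s1 expr1n.
have yK1 : y * (2 * K) <= 1 by rewrite -ler_pdivlMr ?mulr_gt0// div1r.
have yg1 : K ^+ 2 * y <= g (W x0) / 2.
  move: yg; rewrite ler_pdivlMr ?mulr_gt0 ?exprn_gt0//; lra.
(* Both sides of the comparison are linear in [y] to first order: [s * W1] grows at rate at least
   [g (W x0) / 2], and the difference of the exponentials at rate at most [4 * K * E]. *)
pose G t := s * W1 (x0 - s * t).
have [|t ty Gy] := @mean_value R G (fun t => g (W (x0 - s * t))) 0 y y0.
  move=> t _; have dc : is_derive t 1 (fun t => W1 (x0 - s * t))
      (- g (W (x0 - s * t)) * (- s)).
    have da : is_derive t 1 (fun t : R => x0 - s * t) (- s).
      by apply: is_derive_eq; rewrite /GRing.scale/=; ring.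
    by have dWt := dW1 (x0 - s * t); exact: is_derive1_comp.
  rewrite /G; apply: is_derive_eq; rewrite /GRing.scale/=.
  by rewrite mulrN mulNr opprK mulrCA -expr2 s2 mulr1.
have gW : g (W x0) / 2 <= g (W (x0 - s * t)).
  have := le_trans (gL (W (x0 - s * t)) (W x0)) (ler_wpM2l (ltW K0) (W_lip _ _)).
  rewrite addrAC subrr add0r normrN normrM s1 mul1r mulrA -expr2 ger0_norm; last lra.
  have : K ^+ 2 * t <= K ^+ 2 * y by rewrite ler_pM2l ?exprn_gt0//; lra.
  by rewrite ler_norml; lra.
have sW1 : g (W x0) / 2 * y <= s * W1 (x0 - s * y).
  move: Gy; rewrite /G mulr0 subr0 W1_max mulr0 !subr0 => ->.
  by rewrite ler_wpM2r.
have y20 : 0 <= 2 * K * y by rewrite !mulr_ge0// ltW.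
have [|u uy Eu] := @mean_value R (fun u => expR u - expR (- u))
    (fun u => expR u + expR (- u)) 0 (2 * K * y) y20.
  by move=> u _; apply: is_derive_eq; rewrite mulrN1 opprK.
have sinh : expR (2 * K * y) - expR (- (2 * K * y)) =
    (expR u + expR (- u)) * (2 * K * y).
  by move: Eu => /=; rewrite oppr0; lra.
have uE : expR u + expR (- u) <= 2 * E.
  have : expR u <= E by rewrite ler_expR; lra.
  by have : expR (- u) <= E; [rewrite ler_expR|]; lra.
have sinhE : expR (2 * K * y) - expR (- (2 * K * y)) <= 2 * E * (2 * K * y).
  by rewrite sinh ler_wpM2r.
rewrite /perturbation lerD2l ler_pM2l// lerD2r.
have e1 : - (s * (2 * K) * (x0 - s * y - x0)) = 2 * K * y.
  rewrite (_ : 2 * K * y = s ^+ 2 * (2 * K * y)); last by rewrite s2 mul1r.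
  by ring.
have e2 : - (- s * (2 * K) * (x0 - s * y - x0)) = - (2 * K * y).
  rewrite (_ : 2 * K * y = s ^+ 2 * (2 * K * y)); last by rewrite s2 mul1r.
  by ring.
rewrite e1 e2.
have := ler_wpM2l (ltW eta0) sinhE; have := ler_wpM2r y0 eta_kink.
lra.
Qed.

Definition subsolution x : R := Num.max 0
  (if x0 <= x then perturbation 1 eta gam eps x else perturbation (-1) eta gam eps x).

(** Each branch stays below the glued function up to distance [h] beyond [x0], hence on the stencil
    of every point of its half-line; monotonicity of the scheme does the rest. *)
Lemma subsolution_scheme h x : 0 < h <= h0 ->
  subsolution x <= scheme g h subsolution x.
Proof.
move=> hh0; have /andP[hp hle] := hh0.
have hK : tstep h * K <= 1 / 2.
  have hK1 : h * (2 * K) <= 1.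
    by move: hle; rewrite le_min => /andP[+ _]; rewrite -ler_pdivlMr ?mulr_gt0// div1r.
  have h1 : h <= 1 by rewrite (le_trans _ hK1)// ler_peMr ?(ltW hp)//; have := K1; lra.
  have := ler_wpM2l (ltW hp) hK1; rewrite /tstep; lra.
have ge0 z : 0 <= subsolution z by rewrite le_max lexx.
have ge1 z : x0 - h <= z -> perturbation 1 eta gam eps z <= subsolution z.
  move=> zh; rewrite le_max; apply/orP; right; case: ifPn => //; rewrite -ltNge => zx.
  have := @perturbation_kink 1 (x0 - z); rewrite normr1 mul1r subKr; apply=> //.
  by rewrite subr_ge0 (ltW zx)/= (le_trans _ hle)//; lra.
have geN1 z : z <= x0 + h -> perturbation (-1) eta gam eps z <= subsolution z.
  move=> zh; rewrite le_max; apply/orP; right; case: ifPn => // zx.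
  have := @perturbation_kink (-1) (z - x0).
  rewrite (_ : x0 - -1 * (z - x0) = z); last by ring.
  rewrite normrN1 opprK; apply=> //.
  by rewrite subr_ge0 zx/= (le_trans _ hle)//; lra.
rewrite {1}/subsolution ge_max; apply/andP; split.
  have := @scheme_le R g g1 K dg g1K h (cst 0) subsolution x hK (ge0 _) (ge0 _) (ge0 _).
  by rewrite /scheme/= g_0 /avg/=; lra.
case: (leP x0 x) => xx0.
  apply: (@le_trans _ _ (scheme g h (perturbation 1 eta gam eps) x)).
    by apply: perturbation_scheme; rewrite ?normr1 ?mul1r ?subr_ge0.
  by apply: (@scheme_le R g g1 K) => //; apply: ge1; lra.
apply: (@le_trans _ _ (scheme g h (perturbation (-1) eta gam eps) x)).
  by apply: perturbation_scheme; rewrite ?normrN1// mulN1r opprB subr_ge0 ltW.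
by apply: (@scheme_le R g g1 K) => //; apply: geN1; lra.
Qed.

(** At [x0] the perturbing function equals [eta - gam], which is nonnegative. *)
Lemma subsolution_max : W x0 <= subsolution x0.
Proof.
rewrite le_max lexx /perturbation W1_max subrr mulr0 mulr0 oppr0 expR0 add0r mulr1.
by apply/orP; right; rewrite lerDl mulr_ge0 ?(ltW eps0)// subr_ge0.
Qed.

(** The derivative term is at most [K * W x], and the exponential, decaying at twice the Harnack
    rate, is at most [W x / W x0]. *)
Lemma subsolution_le x : subsolution x <=
  Num.max 0 ((1 + eps * (K + eta / W x0)) * W x - eps * gam).
Proof.
rewrite ge_max !le_max lexx/=; apply/orP; right.
have [s s1 [sx ->]] : exists2 s : R, `|s| = 1 & `|x0 - x| = s * (x - x0) /\
    (if x0 <= x then perturbation 1 eta gam eps x else perturbation (-1) eta gam eps x)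
      = perturbation s eta gam eps x.
  have [xx|xx] := leP x0 x.
    by exists 1; rewrite ?normr1// mul1r distrC ger0_norm ?subr_ge0.
  by exists (-1); rewrite ?normrN1// mulN1r opprB ger0_norm ?subr_ge0 1?ltW.
have sW : - s * W1 x <= K * W x.
  by rewrite (le_trans (ler_norm _))// normrM normrN s1 mul1r W1_le.
have psi : expR (- (s * (2 * K) * (x - x0))) * W x0 <= W x.
  rewrite (le_trans _ (W_harnack x0 x))// mulrC ler_pM2l// ler_expR sx.
  have : 0 <= s * (x - x0) by rewrite -sx.
  by move=> /(mulr_ge0 (ltW K0)); lra.
have etapsi : eta * expR (- (s * (2 * K) * (x - x0))) <= eta / W x0 * W x.
  rewrite (_ : eta / W x0 * W x = eta * (W x / W x0)); last by ring.
  by rewrite ler_pM2l// ler_pdivlMr.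
have := ler_wpM2l (ltW eps0) (lerD sW etapsi).
by rewrite /perturbation; lra.
Qed.

End perturbed.

End ground_state.

(** * The competitor *)

Section bounded_lipschitz.
Context {R : realType}.
Implicit Types (F G : R -> R) (x y a : R).

(** A class closed under sums and products, from which the Lipschitz bound on the second derivative
    of the competitor is read off its formula. *)
Definition bounded_lipschitz F := exists2 B : R, 0 <= B &
  forall x y, `|F x| <= B /\ `|F x - F y| <= B * `|x - y|.

Lemma bounded_lipschitz_cst a : bounded_lipschitz (cst a).
Proof.
exists `|a| => // x y; split=> //.
by rewrite /= subrr normr0 mulr_ge0.
Qed.

Lemma bounded_lipschitzD F G : bounded_lipschitz F -> bounded_lipschitz G ->
  bounded_lipschitz (F \+ G).
Proof.
move=> [B B0 FB] [C C0 GC]; exists (B + C); first by rewrite addr_ge0.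
move=> x y; have [F1 F2] := FB x y; have [G1 G2] := GC x y; split.
  by rewrite (le_trans (ler_normD _ _))// lerD.
rewrite mulrDl /= opprD addrACA (le_trans (ler_normD _ _))// lerD//.
Qed.

Lemma bounded_lipschitzM F G : bounded_lipschitz F -> bounded_lipschitz G ->
  bounded_lipschitz (F \* G).
Proof.
move=> [B B0 FB] [C C0 GC]; exists (2 * (B * C)); first by rewrite !mulr_ge0.
move=> x y; have [F1 F2] := FB x y; have [G1 G2] := GC x y.
have [_ [_ F3]] := (FB x y, FB y x); have [G3 _] := GC y x.
have BC : 0 <= B * C by rewrite mulr_ge0.
split=> /=.
  rewrite normrM (le_trans (ler_pM _ _ F1 G1))//; lra.
rewrite (_ : _ - _ = F x * (G x - G y) + (F x - F y) * G y); last by ring.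
rewrite (le_trans (ler_normD _ _))// !normrM.
have t1 := ler_pM (normr_ge0 _) (normr_ge0 _) F1 G2.
have t2 := ler_pM (normr_ge0 _) (normr_ge0 _) F2 G3.
lra.
Qed.

Lemma bounded_lipschitz_derive F (D : R -> R) B : 0 <= B ->
  (forall x, is_derive x 1 F (D x)) ->
  (forall x, `|F x| <= B) -> (forall x, `|D x| <= B) -> bounded_lipschitz F.
Proof.
move=> B0 dF FB DB; exists B => // x y; split=> //.
exact: (@lipschitz_derive R F D).
Qed.

End bounded_lipschitz.

(** * Smooth truncation of the ground state *)

Section truncation.
Context {R : realType}.
Implicit Types (x y z : R).
Variables (g g1 : R -> R) (K : R) (W W1 : R -> R).
Hypothesis dg : forall x, is_derive x 1 g (g1 x).
Hypothesis K1 : 1 <= K.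
Hypothesis g1K : forall x, `|g1 x| <= K.
Hypothesis g_0 : g 0 = 0.
Hypothesis dW : forall x, is_derive x 1 W (W1 x).
Hypothesis dW1 : forall x, is_derive x 1 W1 (- g (W x)).
Hypothesis W01 : forall x, 0 < W x <= 1.

(* The witness is [v = a W ^+ 2 / (W + b)], a smooth majorant of the positive part of
   [a (W - b)] with the integrable tail of [W ^+ 2]. *)
Lemma smooth_truncation (a b : R) : 0 <= a -> 0 < b ->
  exists v v1 v2 : R -> R, exists B : R,
  [/\ (forall x, is_derive x 1 v (v1 x)) /\ (forall x, is_derive x 1 v1 (v2 x)),
      (forall x, `|v1 x| <= B /\ `|v2 x| <= B),
      (forall x y, `|v2 x - v2 y| <= B * `|x - y|),
      (forall x, [/\ 0 <= v x, a * (W x - b) <= v x & v x <= a * W x]) &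
      forall x, b <= W x -> v x <= a * (W x - b / 2)].
Proof.
move=> a0 b0; have K0 : 0 <= K by exact: le_trans K1.
have W0 x : 0 < W x by have /andP[] := W01 x.
have gW_K x : `|g (W x)| <= K.
  exact: le_trans (gW_le g g1 K dg g1K g_0 W W01 x) (ler_piMr K0 (andP (W01 x)).2).
have W1_K x : `|W1 x| <= K.
  exact: (W1_leK g g1 K dg K1 g1K g_0 W W1 dW dW1 W01 x).
pose r x := (W x + b)^-1.
have Wb x : 0 < W x + b by rewrite addr_gt0.
have Wb0 x : W x + b != 0 by rewrite gt_eqF.
have r0 x : 0 < r x by rewrite invr_gt0.
have rb x : r x <= b^-1 by rewrite lef_pV2 ?posrE// lerDr ltW.
have dr x : is_derive x 1 r (- (r x ^+ 2 * W1 x)).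
  have dWx := dW x; have dWb : is_derive x 1 (fun y => W y + b) (W1 x).
    by apply: is_derive_eq; rewrite addr0.
  have := @is_deriveV R (fun y => W y + b) x (W1 x) 1 (Wb0 x) dWb.
  by rewrite /r -exprVn /GRing.scale/= mulNr.
have blW1 : bounded_lipschitz W1.
  apply: (bounded_lipschitz_derive W1 (fun x => - g (W x)) K) => // x.
  by rewrite normrN.
have blgW : bounded_lipschitz (fun x => g (W x)).
  apply: (bounded_lipschitz_derive _ (fun x => g1 (W x) * W1 x) (K * K)) => //.
  - by rewrite mulr_ge0.
  - by move=> x; rewrite (le_trans (gW_K x))// ler_peMr.
  - by move=> x; rewrite normrM ler_pM.
have blr : bounded_lipschitz r.
  have ib0 : 0 <= b^-1 by rewrite invr_ge0 ltW.
  apply: (bounded_lipschitz_derive r (fun x => - (r x ^+ 2 * W1 x))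
    (b^-1 + b^-1 ^+ 2 * K)) => //.
  - by rewrite addr_ge0// mulr_ge0// sqr_ge0.
  - move=> x; rewrite (gtr0_norm (r0 x)) (le_trans (rb x))// lerDl.
    by rewrite mulr_ge0// sqr_ge0.
  - move=> x; have rb2 : r x ^+ 2 <= b^-1 ^+ 2 by rewrite lerXn2r// nnegrE ltW.
    have := ler_pM (sqr_ge0 (r x)) (normr_ge0 (W1 x)) rb2 (W1_K x).
    by rewrite normrN normrM ger0_norm ?sqr_ge0//; lra.
have blc (c : R) : bounded_lipschitz (fun=> c) by exact: bounded_lipschitz_cst.
(* Division gives [W ^+ 2 / (W + b) = W - b + b ^+ 2 / (W + b)], polynomial in [W] and [r]; the
   derivatives are then sums and products of bounded Lipschitz functions. *)
pose v x := a * (W x - b + b ^+ 2 * r x).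
pose v1 x := a * (W1 x * (1 - b ^+ 2 * (r x * r x))).
pose v2 x := a * (- 1 * (g (W x) * (1 + - b ^+ 2 * (r x * r x)))
  + 2 * b ^+ 2 * (r x * (r x * r x)) * (W1 x * W1 x)).
have [B1 B10 HB1] : bounded_lipschitz v1.
  rewrite (_ : v1 = (fun=> a) \* (W1 \* ((fun=> 1) \+ ((fun=> - b ^+ 2) \* (r \* r))))).
    by do !(apply: bounded_lipschitzM || apply: bounded_lipschitzD ||
      exact: blc || assumption).
  by apply/funext => x; rewrite /v1 /= mulNr.
have [B2 B20 HB2] : bounded_lipschitz v2.
  rewrite (_ : v2 = (fun=> a) \* (((fun=> -1) \* ((fun x => g (W x)) \*
    ((fun=> 1) \+ ((fun=> - b ^+ 2) \* (r \* r))))) \+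
    ((fun=> 2 * b ^+ 2) \* (r \* (r \* r))) \* (W1 \* W1)))//.
  by do !(apply: bounded_lipschitzM || apply: bounded_lipschitzD ||
    exact: blc || assumption).
exists v, v1, v2, (B1 + B2); split.
- split=> x; have dWx := dW x; have dW1x := dW1 x; have drx := dr x.
    by rewrite /v /v1; apply: is_derive_eq; rewrite /GRing.scale/=; ring.
  by rewrite /v1 /v2; apply: is_derive_eq; rewrite /GRing.scale/=; ring.
- by move=> x; have [? _] := HB1 x x; have [? _] := HB2 x x; split; lra.
- move=> x y; have [_ /le_trans] := HB2 x y; apply.
  by rewrite ler_wpM2r// lerDr.
- move=> x; have rE : (W x + b) * r x = 1 by rewrite divff.
  have brb : b * r x <= 1 by have := mulr_gt0 (W0 x) (r0 x); lra.
  rewrite /v !ler_wpM2l//.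
  + split=> //; rewrite mulr_ge0//.
    rewrite (_ : _ + _ = W x ^+ 2 * r x); last first.
      by have := congr1 (fun t => (W x - b) * t) rE; lra.
    by rewrite mulr_ge0 ?sqr_ge0// ltW.
  + have := ler_wpM2l (ltW b0) brb; lra.
  + by rewrite lerDl mulr_ge0 ?sqr_ge0// ltW.
- move=> x bW; rewrite /v ler_wpM2l//.
  have rE : (W x + b) * r x = 1 by rewrite divff.
  have := ler_wpM2r (ltW (r0 x)) bW => bWr.
  have brb : b * r x <= 1 / 2 by lra.
  have := ler_wpM2l (ltW b0) brb; lra.
Qed.

End truncation.

(** * Comparison of integrals and conclusion *)

Section conclusion.
Context {R : realType}.
Local Notation mu := (@lebesgue_measure R).
Implicit Types (f v w W : R -> R) (u : R -> R -> R) (x t N q : R).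

Lemma limf_esup_pinfty_gt0 (u : R -> R -> R) x m : 0 < m -> (forall t, m <= u t x) ->
  (0 < limf_esup (fun t => ereal_sup (range (fun x => (u t x)%:E))) +oo%R)%E.
Proof.
move=> m0 um; apply: (@lt_le_trans _ _ m%:E); first by rewrite lte_fin.
rewrite limf_esupE; apply: le_ereal_inf_tmp => _ [A FA <-].
have [t At] := filter_ex FA.
apply: (@le_trans _ _ (ereal_sup (range (fun x => (u t x)%:E)))).
  apply: (@le_trans _ _ (u t x)%:E); first by rewrite lee_fin.
  by apply: ereal_sup_ubound; exists x.
by apply: ereal_sup_ubound; exists t.
Qed.

Lemma Rintegral_deficit w v x N q : 0 <= N ->
  mu.-integrable setT (EFin \o w) -> mu.-integrable setT (EFin \o v) ->
  (forall y, v y <= w y) -> (forall y, `|y - x| <= N -> v y + q <= w y) ->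
  \int[mu]_y v y + q * (2 * N) <= \int[mu]_y w y.
Proof.
move=> N0 iw iv vw vqw.
have iD : mu.-integrable setT (EFin \o (fun y => w y - v y)).
  by have := integrableB measurableT iw iv.
have mA : measurable (`[x - N, x + N]%classic : set R) by exact: measurable_itv.
have D0 y : 0 <= w y - v y by rewrite subr_ge0.
have := Rintegral_subset (fun y => w y - v y) _ _ mA measurableT (@subsetT _ _) iD D0.
rewrite (RintegralB (D := setT))// => H.
suff : q * (2 * N) <= \int[mu]_(y in `[x - N, x + N]) (w y - v y).
  by move=> /le_trans/(_ H); rewrite lerBrDl.
have -> : q * (2 * N) = \int[mu]_(y in `[x - N, x + N]) cst q y.
  rewrite Rintegral_cst//.
  suff -> : fine (mu ([set` `[x - N, x + N]%R] : set R)) = 2 * N by [].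
  rewrite lebesgue_measure_itv/= lte_fin; case: ltP => [_|NN].
    by rewrite -EFinB/=; ring.
  by have -> : N = 0; [lra|rewrite mulr0].
apply: le_Rintegral => //.
- apply: continuous_compact_integrable; first exact: segment_compact.
  by move=> z; exact: cvg_cst.
- by apply: integrableS iD.
- by move=> y /=; rewrite in_itv/= => yN; rewrite lerBrDl vqw// ler_norml; lra.
Qed.

End conclusion.

Theorem corollary1p8 (R : realType) (f : R -> R)
    (f_C2 : C2_on `[0, 1] f) (f0 : f 0 = 0) (f1 : f 1 = 0)
    (f_bistable : bistable f)
    (W : R -> R) (W_H1 : H1 W) (W_range : forall x, 0 < W x <= 1)
    (W_sol : stationary_solution f W) :
  ~ is_minimizer (fun u0 : R -> R => \int[lebesgue_measure]_x u0 x)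
      (persistent_data f) W.
Proof.
(* Membership of [W] in [persistent_data] provides its integrability. *)
move=> [[W_L1 _ _] W_min].
have [_ [_ _ _ _ [_ df0]]] := f_bistable.
have [g [g1 [g2 [K [[dg dg1] K1 [g1K g2K] g2_cts [gf g1f]]]]]] := C2_extension f f_C2.
rewrite -g1f in df0.
have g_0 : g 0 = 0 by rewrite gf ?lexx ?ler01.
have g_1 : g 1 = 0 by rewrite gf ?lexx ?ler01.
have fg x : 0 <= x <= 1 -> f x = g x by move=> /gf.
have K0 : 0 < K by exact: lt_le_trans K1.
have W0 x : 0 < W x by have /andP[] := W_range x.
pose W1 := derive1 W.
have dW (x : R) : is_derive x 1 W (W1 x).
  by have [/derivableP dWx _ _] := W_sol x; rewrite /W1 derive1E.
have dW1 (x : R) : is_derive x 1 W1 (- g (W x)).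
  have [_ /derivableP dW1x E] := W_sol x.
  rewrite -fg ?(ltW (W0 x))/=; last by have /andP[_ ->] := W_range x.
  by rewrite -E opprK /derive1n/= [X in is_derive _ _ _ X]derive1E.
have iW : lebesgue_measure.-integrable setT (EFin \o W) by exact/Lfun1_integrable.
have harn := W_harnack g g1 K dg K1 g1K g_0 W W1 dW dW1 W_range.
have W_vanish := vanishing_at_infinity W K iW W0 (ltW K0) harn.
have [x0 W_max] := W_max_exists W W1 dW W_range W_vanish.
have gm0 : 0 < g (W x0).
  exact: (g_max_gt0 g g1 K dg K1 g1K g_0 W W1 dW dW1 W_range W_vanish x0 W_max).
have m1 : W x0 < 1.
  exact: (W_max_lt1 g g1 K dg K1 g1K g_0 g_1 W W1 dW dW1 W_range W_vanish x0 W_max).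
have m0 := W0 x0.
(* Half of [- g1 0]: once [W x <= c / K], the Lipschitz bound on [g1] gives [g1 (W x) <= - c]. *)
pose c := - g1 0 / 2; have c00 : 0 < c by rewrite /c; lra.
have cK : c <= K by have := g1K 0; rewrite ler_norml /c; lra.
have c0 : 0 < c <= K by rewrite c00.
have [Y HY] := W_vanish (c / K) (divr_gt0 c00 K0).
pose X := `|Y| + `|x0|; have X0 : 0 <= X by rewrite addr_ge0.
have g1W x : X <= `|x - x0| -> g1 (W x) <= - c.
  move=> xX; have /HY Wx : Y <= `|x|.
    by have := ler_normB x x0; have := ler_norm Y; rewrite /X in xX; lra.
  have : `|g1 (W x) - g1 0| <= K * `|W x - 0| by exact: (@lipschitz_derive R g1 g2).
  rewrite subr0 (gtr0_norm (W0 x)).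
  move: Wx; rewrite ler_pdivlMr// mulrC => Wx.
  have cE : g1 0 = - 2 * c by rewrite /c; lra.
  by rewrite ler_norml; lra.
pose E := expR (1 : R); have E0 : 0 < E by exact: expR_gt0.
have KE0 : 0 < 4 * K * E by rewrite !mulr_gt0.
pose eta := Num.min 1 (g (W x0) / (4 * K * E)).
have eta01 : 0 < eta <= 1 by rewrite lt_min ltr01 divr_gt0//= ge_min lexx.
have eta0 : 0 < eta by have /andP[] := eta01.
have eta_kink : eta * (4 * K * E) <= g (W x0).
  by rewrite -ler_pdivlMr// ge_min lexx orbT.
pose gam := eta * expR (- (2 * K * X)).
have gam0 : 0 < gam by rewrite mulr_gt0// expR_gt0.
pose C := K + eta / W x0; have C0 : 0 < C by rewrite addr_gt0// divr_gt0.
pose I := \int[lebesgue_measure]_x W x.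
(* The gain [eps * gam / 2] over an interval of length [2 * N] has to exceed the excess
   [eps * (C * I)]; the summand 1 makes this strict. [N] does not involve [eps], so [eps] may be
   chosen small in terms of it. *)
pose N := (C * `|I|) / gam + 1.
have N0 : 0 <= N by rewrite addr_ge0// divr_ge0 ?(ltW gam0)// mulr_ge0// ltW.
have CI : C * I < gam * N.
  have -> : gam * N = C * `|I| + gam by rewrite /N mulrDr mulr1 mulrC divfK ?gt_eqF.
  by have := ler_wpM2l (ltW C0) (ler_norm I); lra.
pose H := K + E + 1; have H0 : 0 < H by rewrite !addr_gt0.
have KH0 : 0 < K * H ^+ 2 by rewrite mulr_gt0// exprn_gt0.
(* By the Harnack inequality, a lower bound for [W] within distance [N] of [x0]. *)
pose cN := W x0 * expR (- K * N); have cN0 : 0 < cN by rewrite mulr_gt0// expR_gt0.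
(* [epsH] gives the strict subsolution, [epsC] keeps the competitor at most 1, and [epsN] ensures
   [b <= W] within distance [N] of [x0]. *)
have [eps [eps01 epsH epsC epsN]] : exists eps : R, [/\ 0 < eps <= 1,
    eps * (K * H ^+ 2) <= gam * c / 2, eps * C <= 1 - W x0 & eps * gam <= cN].
  have gc0 : 0 < gam * c / 2 by rewrite divr_gt0// mulr_gt0.
  have p1 : 0 < gam * c / 2 / (K * H ^+ 2) by rewrite divr_gt0.
  have p2 : 0 < (1 - W x0) / C by rewrite divr_gt0// subr_gt0.
  have p3 : 0 < cN / gam by rewrite divr_gt0.
  exists (Num.min (Num.min 1 (gam * c / 2 / (K * H ^+ 2)))
    (Num.min ((1 - W x0) / C) (cN / gam))).
  rewrite -!ler_pdivlMr// !lt_min !ge_min !lexx !orbT /=; split=> //.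
  by rewrite ltr01 p1 p2 p3.
have eps0 : 0 < eps by have /andP[] := eps01.
pose a := 1 + eps * C; have a0 : 0 < a by rewrite addr_gt0// mulr_gt0.
have a1 : 1 <= a by rewrite lerDl ltW// mulr_gt0.
pose b := eps * gam / a; have b0 : 0 < b by rewrite divr_gt0// mulr_gt0.
have abE : a * b = eps * gam by rewrite mulrC divfK// gt_eqF.
have [v [v1 [v2 [B [[dv dv1] vB vL v_le v_leb]]]]] :=
  smooth_truncation g g1 K W W1 dg K1 g1K g_0 dW dW1 W_range a b (ltW a0) b0.
have v01 x : 0 <= v x <= 1.
  have [-> _ /= vW] := v_le x; apply: le_trans vW _.
  apply: le_trans (ler_wpM2l (ltW a0) (W_max x)) _.
  have : eps * C * W x0 <= (1 - W x0) * W x0 by rewrite ler_pM2r.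
  by have := sqr_ge0 (1 - W x0); rewrite /a; lra.
have g2c := heine_itv g2 0 1 g2_cts.
have [u u_sol u_ge] := cauchy_solution_exists g g1 g2 K dg dg1 K1 g1K g2K g2c
  g_0 g_1 v v1 v2 B dv dv1 v01 (fun x => (vB x).1) (fun x => (vB x).2) vL f fg.
pose w := subsolution K W W1 x0 eta gam eps.
(* The chain is W(x0) <= w(x0) <= u(t, x0), where w <= v holds since [a * W - eps * gam] equals
   [a * (W - b)]. *)
have u_max t : W x0 <= u t x0.
  apply: le_trans (subsolution_max K K1 W W1 dW x0 W_max X eta gam eps X0 eta01
    (erefl _) eps01) _.
  apply: (u_ge w _ (perturbation_step_gt0 g g1 K dg K1 g1K g_0 W W1 dW dW1 W_range
    W_vanish x0 W_max c X eta gam eps c0 eta01 (erefl _) eps01)).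
  - move=> h x; exact: (subsolution_scheme g g1 g2 K dg dg1 K1 g1K g2K g_0 W W1 dW dW1
      W_range x0 W_max c X eta gam eps X0 c0 g1W eta01 eta_kink (erefl _) eps01 epsH).
  - move=> x; apply: le_trans (subsolution_le g g1 K dg K1 g1K g_0 W W1 dW dW1 W_range
      x0 eta gam eps eta01 eps01 x) _.
    have [v0 av _] := v_le x; rewrite ge_max v0 /= (le_trans _ av)//.
    by rewrite mulrBr abE.
have iaW : lebesgue_measure.-integrable setT (EFin \o (fun x => a * W x)).
  by have := integrableZl measurableT a iW.
have iv : lebesgue_measure.-integrable setT (EFin \o v).
  apply: le_integrable iaW => //.
    apply/measurable_EFinP; apply: continuous_measurable_fun => x.
    exact: is_derive_continuous (dv x).
  move=> x _ /=; have [vge _ vle] := v_le x.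
  by rewrite lee_fin !ger0_norm// mulr_ge0// ltW.
have v_data : persistent_data f v.
  split; first exact/Lfun1_integrable.
    by apply: aeW => x; exact: v01.
  by exists u => //; exact: limf_esup_pinfty_gt0 m0 u_max.
have := W_min v v_data.
(* Against [a * W] the competitor loses [a * b / 2 = eps * gam / 2] on the interval of length
   [2 * N]. With the choice of [N] its integral falls below [I], contradicting minimality. *)
have : \int[lebesgue_measure]_y v y + eps * gam / 2 * (2 * N) <= a * I.
  rewrite -RintegralZl//; apply: (Rintegral_deficit _ _ x0) => // y.
    by have [] := v_le y.
  move=> yN; have bW : b <= W y.
    apply: (@le_trans _ _ (eps * gam)).
      by rewrite -abE ler_peMl// ltW.
    rewrite (le_trans epsN)// (le_trans _ (harn x0 y))// ler_pM2l// ler_expR.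
    by rewrite !mulNr lerN2 ler_pM2l// distrC.
  have := v_leb y bW; rewrite mulrBr mulrA abE; lra.
have : eps * (C * I) < eps * (gam * N) by rewrite ltr_pM2l.
rewrite /a -/I; lra.
Qed.
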